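(* Let $f$ be a non-zero modular function for $\mathrm{SL}_2(\mathbb{Z})$ of real weight $k\geqslant0$, holomorphic on the upper half plane $\mathfrak{H}$, with expansion $f(z)=\sum_{\lambda\in\Lambda}a(\lambda)e^{2\pi i\lambda z}$ at $\infty$. Assume that $f$ is not finite at $\infty$, i.e. that there is at least one $\mu<0$ in $\Lambda$ with $a(\mu)\neq0$. Then there exists $\lambda_0\in\mathbb{R}_+$ such that $a(\lambda)\neq0$ for all $\lambda\geqslant\lambda_0$ in $\Lambda$.
   Context: $\mathfrak{H}=\{z\in\mathbb{C}:\mathrm{Im}(z)>0\}$. A holomorphic function $f$ on $\mathfrak{H}$ is a modular function of real weight $k$ for $\mathrm{SL}_2(\mathbb{Z})$ if: for every $\gamma=\begin{pmatrix}a&b\\c&d\end{pmatrix}\in\mathrm{SL}_2(\mathbb{Z})$ one has $f(\gamma z)=j(\gamma,z)f(z)$, where $\gamma z=\frac{az+b}{cz+d}$ and $j(\gamma,\cdot)$ is a holomorphic function on $\mathfrak{H}$ with $|j(\gamma,z)|=|cz+d|^k$; and $f$ has finite order at the cusps. The function $j\left(\begin{pmatrix}1&1\\0&1\end{pmatrix},z\right)$ is a constant $u$ with $|u|=1$, so $f(z+1)=u f(z)$ and $f$ has a unique expansion $f(z)=\sum_{\lambda\in\Lambda}a(\lambda)e^{2\pi i\lambda z}$ with $\Lambda=\{\lambda\in\mathbb{R}:e^{2\pi i\lambda}=u\}$; the finite order condition means that there are only finitely many $\lambda<0$ in $\Lambda$ with $a(\lambda)\ne0$. *)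

(* Defs.v *)
From Stdlib Require Import Reals ZArith List.
From Coquelicot Require Import Coquelicot.

Open Scope R_scope.

Definition UHP (z : C) : Prop := 0 < Im z.

(* Holomorphy on the open set UHP; the values off UHP are irrelevant, since
   [ex_derive] at a point only depends on the germ there. *)
Definition holomorphic_on_UHP (f : C -> C) : Prop :=
  forall z : C, UHP z -> @ex_derive C_AbsRing C_NormedModule f z.

Record SL2Z : Type := mkSL2Z {
  sl_a : Z; sl_b : Z; sl_c : Z; sl_d : Z;
  sl_det : (sl_a * sl_d - sl_b * sl_c = 1)%Z
}.

Definition ZtoC (n : Z) : C := RtoC (IZR n).

Definition denom (g : SL2Z) (z : C) : C :=
  (ZtoC (sl_c g) * z + ZtoC (sl_d g))%C.

Definition moebius (g : SL2Z) (z : C) : C :=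
  ((ZtoC (sl_a g) * z + ZtoC (sl_b g)) / denom g z)%C.

Definition translation : SL2Z := mkSL2Z 1 1 0 1 eq_refl.

Definition Cexp (z : C) : C :=
  (RtoC (exp (Re z)) * (cos (Im z), sin (Im z)))%C.

Definition e2pii (z : C) : C := Cexp (RtoC (2 * PI) * Ci * z)%C.

Definition Lambda (u : C) (l : R) : Prop := e2pii (RtoC l) = u.

Definition list_Csum (g : R -> C) (F : list R) : C :=
  fold_right (fun l s => Cplus (g l) s) (RtoC 0) F.

(* The family (g l), l in L, has the unconditional sum s: the finite partial
   sums, indexed by the finite subsets of L ordered by inclusion, tend to s.
   This is how a sum over Lambda is understood; it avoids the choice of an
   enumeration of Lambda, and for complex terms it means absolute convergence.
   That F itself lies in L matters: otherwise no G would qualify. *)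
Definition is_sum_over (L : R -> Prop) (g : R -> C) (s : C) : Prop :=
  forall eps : posreal, exists F : list R,
    (forall l, In l F -> L l) /\
    forall G : list R, NoDup G -> (forall l, In l G -> L l) -> incl F G ->
      Cmod (list_Csum g G - s)%C < eps.

(* Only the values of a on Lambda u matter. *)
Definition has_expansion (f : C -> C) (u : C) (a : R -> C) : Prop :=
  forall z : C, UHP z ->
    is_sum_over (Lambda u) (fun l => (a l * e2pii (RtoC l * z))%C) (f z).

Definition finite_order (f : C -> C) (j : SL2Z -> C -> C) : Prop :=
  exists (u : C) (a : R -> C),
    (forall z : C, UHP z -> j translation z = u) /\
    has_expansion f u a /\
    exists S : list R,
      forall l : R, Lambda u l -> l < 0 -> a l <> RtoC 0 -> In l S.

(* c z + d never vanishes on UHP, so [Rpower] is applied to a positive base.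
   As all cusps of SL2(Z) are equivalent, infinity is the only one at which
   the order has to be considered. *)
Definition modular_function (k : R) (f : C -> C) (j : SL2Z -> C -> C) : Prop :=
  holomorphic_on_UHP f /\
  (forall g : SL2Z,
     holomorphic_on_UHP (j g) /\
     forall z : C, UHP z ->
       Cmod (j g z) = Rpower (Cmod (denom g z)) k /\
       f (moebius g z) = (j g z * f z)%C) /\
  finite_order f j.

(* Main.v *)
Require Import Defs.
From Stdlib Require Import Reals ZArith List Lra Lia Permutation Classical.
From Coquelicot Require Import Coquelicot.

(** Circle method.  Let [-m] be the lowest exponent of [f].  The coefficient
    [a(lambda) exp (-2 pi lambda y)] is the integral of
    [f(x+iy) e(-lambda x)] over [|x| <= 1/2]; take [y = sqrt (m / lambda)], so
    that [z = iy] is a saddle point of [m/z - lambda z].  Inverting,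
    [f(z) = f(-1/z) / J(z)] with [|J(z)| = |z|^k], and where
    [Im(-1/z) >= 1/2] this is [a(-m) e(m/z) / J(z)] up to an exponentially
    smaller error.  Elsewhere, every further inversion at least doubles the
    imaginary part while it is below 1/2, so [f] is
    [O(y^(-k) exp (pi m / y))], against [exp (2 pi m / y)] for the main term.
    On the scale [t = x / y], [N = m / y], the integrand near the saddle is a
    positive multiple of [exp (- 2 pi N t^2) (1 + O(t) + O(N t^3))] after
    rotation by a constant, and its integral, of order [N^(-1/2)], cannot be
    cancelled by the errors once [N] is large. *)

Open Scope R_scope.

(** Of the automorphy factor only the modulus is given, so there is no formula for J and no branch
    of z^k to expand. What replaces it is rigidity: |J| determines a holomorphic J up to a constant
    phase, and quantitatively |J| = |z|^k forces |J'| <= k |z|^(k-1). Hence J(iy) / J(z) = 1 + O(k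
    t) near the saddle, and the unknown phase of J(iy) disappears in the constant rotation. The
    factor y^(-k) of the error is cancelled by |J(iy)| = y^k.

    No integral is ever formed: a minorant of the real part of the integrand is compared, through
    primitives, with finite partial sums of the expansion. The price is that the minorant must have
    an elementary primitive, which a Gaussian lacks. The inserted factor sqrt(N) t keeps the order
    N^(-1/2) of the integral over t, while the corrections t exp(-2 N t^2) contribute O(1/N) and the
    remaining errors are exponentially small. The surplus sqrt(N) decides the sign. *)

(** * Finite sums over lists and unconditional summability *)

Definition list_Rsum (g : R -> R) (F : list R) : R :=
  fold_right (fun l s => g l + s) 0 F.

Lemma list_Csum_cons (g : R -> C) (l : R) (F : list R) :
  list_Csum g (l :: F) = (g l + list_Csum g F)%C.
Proof. reflexivity. Qed.

Lemma list_Csum_app (g : R -> C) (F G : list R) :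
  list_Csum g (F ++ G) = (list_Csum g F + list_Csum g G)%C.
Proof.
  induction F as [|x F IH]; simpl; [ring | rewrite IH; ring].
Qed.

Lemma list_Csum_perm (g : R -> C) (F G : list R) :
  Permutation F G -> list_Csum g F = list_Csum g G.
Proof.
  induction 1; simpl; try congruence; ring.
Qed.

Lemma Cmod_list_Csum_le (g : R -> C) (F : list R) :
  Cmod (list_Csum g F) <= list_Rsum (fun l => Cmod (g l)) F.
Proof.
  induction F as [|x F IH]; simpl; [rewrite Cmod_0; lra|].
  eapply Rle_trans; [apply Cmod_triangle|lra].
Qed.

Lemma list_Rsum_app (g : R -> R) (F G : list R) :
  list_Rsum g (F ++ G) = list_Rsum g F + list_Rsum g G.
Proof.
  induction F as [|x F IH]; simpl; [ring | rewrite IH; ring].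
Qed.

Lemma list_Rsum_perm (g : R -> R) (F G : list R) :
  Permutation F G -> list_Rsum g F = list_Rsum g G.
Proof.
  induction 1; simpl; try congruence; ring.
Qed.

Lemma list_Rsum_le (g h : R -> R) (F : list R) :
  (forall l, In l F -> g l <= h l) -> list_Rsum g F <= list_Rsum h F.
Proof.
  induction F as [|x F IH]; simpl; intros H; [lra|].
  apply Rplus_le_compat; auto.
Qed.

Lemma list_Rsum_ext (g h : R -> R) (F : list R) :
  (forall l, g l = h l) -> list_Rsum g F = list_Rsum h F.
Proof. intros H; induction F; simpl; congruence. Qed.

Lemma list_Rsum_scal (c : R) (g : R -> R) (F : list R) :
  list_Rsum (fun l => c * g l) F = c * list_Rsum g F.
Proof. induction F as [|x F IH]; simpl; [ring | rewrite IH; ring]. Qed.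

Lemma list_Rsum_ge_0 (g : R -> R) (F : list R) :
  (forall l, 0 <= g l) -> 0 <= list_Rsum g F.
Proof.
  intros H; induction F as [|x F IH]; simpl; [lra|].
  specialize (H x); lra.
Qed.

Lemma incl_perm_app (F G : list R) :
  NoDup F -> incl F G -> exists H, Permutation G (F ++ H).
Proof.
  intros HF; revert G; induction HF as [|x F Hx HF IH]; intros G HG.
  - exists G; apply Permutation_refl.
  - destruct (in_split x G) as [G1 [G2 E]]; [apply HG; now left|].
    destruct (IH (G1 ++ G2)) as [H HH].
    + intros l Hl. assert (In l G) by (apply HG; now right).
      subst G. apply in_app_or in H. apply in_or_app.
      destruct H as [H|[H|H]]; auto. congruence.
    + exists H. subst G. simpl.
      eapply perm_trans; [apply Permutation_sym, Permutation_middle|].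
      now constructor.
Qed.

Lemma NoDup_app_disjoint (F H : list R) :
  NoDup (F ++ H) -> forall l, In l H -> ~ In l F.
Proof.
  induction F as [|x F IH]; simpl; intros N l Hl Hl'; [easy|].
  inversion_clear N. destruct Hl' as [->|Hl'].
  - apply H0, in_or_app; now right.
  - exact (IH H1 l Hl Hl').
Qed.

Lemma NoDup_app_intro (F H : list R) :
  NoDup F -> NoDup H -> (forall l, In l H -> ~ In l F) -> NoDup (F ++ H).
Proof.
  induction 1 as [|x F Hx HF IH]; simpl; intros NH D; [easy|].
  constructor.
  - intros Hi; apply in_app_or in Hi; destruct Hi as [Hi|Hi]; [easy|].
    apply (D x Hi); now left.
  - apply IH; [easy|]. intros l Hl Hl'; apply (D l Hl); now right.
Qed.

Lemma list_Rsum_Rabs_filter (g : R -> R) (H : list R) :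
  list_Rsum (fun l => Rabs (g l)) H =
  list_Rsum g (filter (fun l => if Rle_dec 0 (g l) then true else false) H) -
  list_Rsum g (filter (fun l => if Rle_dec 0 (g l) then false else true) H).
Proof.
  induction H as [|x H IH]; simpl; [ring|].
  destruct (Rle_dec 0 (g x)) as [h|h]; simpl; rewrite IH.
  - rewrite (Rabs_pos_eq _ h); ring.
  - rewrite Rabs_left by lra; ring.
Qed.

Lemma Re_list_Csum (g : R -> C) (F : list R) :
  Re (list_Csum g F) = list_Rsum (fun l => Re (g l)) F.
Proof. induction F as [|x F IH]; simpl; [easy|]. rewrite <- IH; reflexivity. Qed.

Lemma Im_list_Csum (g : R -> C) (F : list R) :
  Im (list_Csum g F) = list_Rsum (fun l => Im (g l)) F.
Proof. induction F as [|x F IH]; simpl; [easy|]. rewrite <- IH; reflexivity. Qed.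

Lemma Rabs_Im_le_Cmod (c : C) : Rabs (Im c) <= Cmod c.
Proof.
  eapply Rle_trans; [apply Rmax_r | apply Rmax_Cmod].
Qed.

Lemma Cmod_le_Re_Im (c : C) : Cmod c <= Rabs (Re c) + Rabs (Im c).
Proof.
  assert (H := Cmod2_alt c). assert (H1 := Cmod_ge_0 c).
  assert (H2 := Rabs_pos (Re c)). assert (H3 := Rabs_pos (Im c)).
  rewrite <- (pow2_abs (Re c)), <- (pow2_abs (Im c)) in H.
  nra.
Qed.

Lemma Cmod_minus_sym (x y : C) : Cmod (x - y) = Cmod (y - x).
Proof. rewrite <- Cmod_opp. f_equal. ring. Qed.

Lemma Cmod_minus_triangle (x y z : C) : Cmod (x - z) <= Cmod (x - y) + Cmod (y - z).
Proof.
  replace (x - z)%C with ((x - y) + (y - z))%C by ring. apply Cmod_triangle.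
Qed.

(** Sorting the terms by the sign of the real part, and again by that of the imaginary part, gives
    four subfamilies on which no cancellation occurs; each contributes at most [e]. *)
Lemma list_norm_sum_le (g : R -> C) (e : R) (H : list R) :
  (forall p : R -> bool, Cmod (list_Csum g (filter p H)) <= e) ->
  list_Rsum (fun l => Cmod (g l)) H <= 4 * e.
Proof.
  intros Hs.
  apply Rle_trans with (list_Rsum (fun l => Rabs (Re (g l))) H +
                        list_Rsum (fun l => Rabs (Im (g l))) H).
  - clear Hs; induction H as [|x H IH]; simpl; [lra|].
    assert (h := Cmod_le_Re_Im (g x)). lra.
  - rewrite (list_Rsum_Rabs_filter (fun l => Re (g l))).
    rewrite (list_Rsum_Rabs_filter (fun l => Im (g l))).
    rewrite <- !Re_list_Csum, <- !Im_list_Csum.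
    match goal with |- Re (list_Csum _ (filter ?p1 _)) - Re (list_Csum _ (filter ?p2 _))
      + (Im (list_Csum _ (filter ?p3 _)) - Im (list_Csum _ (filter ?p4 _))) <= _ =>
      assert (H1 := Hs p1); assert (H2 := Hs p2);
      assert (H3 := Hs p3); assert (H4 := Hs p4) end.
    match type of H1 with Cmod ?x <= _ => assert (K1 := re_le_Cmod x) end.
    match type of H2 with Cmod ?x <= _ => assert (K2 := re_le_Cmod x) end.
    match type of H3 with Cmod ?x <= _ => assert (K3 := Rabs_Im_le_Cmod x) end.
    match type of H4 with Cmod ?x <= _ => assert (K4 := Rabs_Im_le_Cmod x) end.
    apply Rabs_le_between in K1, K2, K3, K4. lra.
Qed.

(** Cauchy criterion: any subfamily of [H] is the difference of two partial sums containing [F1],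
    each within [eps / 8] of [s]; the factor 4 of [list_norm_sum_le] then gives [eps]. The list [F0]
    allows a given exponent to be forced into [F]. *)
Lemma is_sum_over_tail (L : R -> Prop) (g : R -> C) (s : C) (F0 : list R) (eps : R) :
  is_sum_over L g s -> (forall l, In l F0 -> L l) -> 0 < eps ->
  exists F : list R, NoDup F /\ incl F0 F /\ (forall l, In l F -> L l) /\
    forall H : list R, NoDup (F ++ H) -> (forall l, In l H -> L l) ->
      list_Rsum (fun l => Cmod (g l)) H <= eps.
Proof.
  intros Hg H0 He.
  assert (He8 : 0 < eps / 8) by lra.
  destruct (Hg (mkposreal _ He8)) as [F1 [HF1 Hsum]]; simpl in Hsum.
  exists (nodup Req_EM_T (F0 ++ F1)).
  assert (NF := NoDup_nodup Req_EM_T (F0 ++ F1)).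
  assert (LF : forall l, In l (nodup Req_EM_T (F0 ++ F1)) -> L l).
  { intros l Hl; apply nodup_In, in_app_or in Hl; destruct Hl; auto. }
  assert (IF : incl F1 (nodup Req_EM_T (F0 ++ F1))).
  { intros l Hl; apply nodup_In, in_or_app; now right. }
  assert (IF0 : incl F0 (nodup Req_EM_T (F0 ++ F1))).
  { intros l Hl; apply nodup_In, in_or_app; now left. }
  set (F := nodup Req_EM_T (F0 ++ F1)) in *. clearbody F.
  repeat split; auto.
  intros H NH LH.
  replace eps with (4 * (2 * (eps / 8))) by field.
  apply list_norm_sum_le. intros p.
  assert (K1 := Hsum F NF LF IF).
  assert (K2 : Cmod (list_Csum g (F ++ filter p H) - s) < eps / 8).
  { apply Hsum.
    - apply NoDup_app_intro; [easy| |].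
      + apply NoDup_filter. now apply NoDup_app_remove_l in NH.
      + intros l Hl. apply filter_In in Hl.
        now apply (NoDup_app_disjoint F H).
    - intros l Hl; apply in_app_or in Hl; destruct Hl as [Hl|Hl]; auto.
      apply filter_In in Hl; apply LH, Hl.
    - intros l Hl; apply in_or_app; left; auto. }
  rewrite list_Csum_app in K2.
  replace (list_Csum g (filter p H)) with
    ((list_Csum g F + list_Csum g (filter p H) - s) - (list_Csum g F - s))%C by ring.
  unfold Cminus at 1. eapply Rle_trans; [apply Cmod_triangle|].
  rewrite Cmod_opp. lra.
Qed.

Lemma list_Rsum_incl (g : R -> R) (G F : list R) :
  (forall l, 0 <= g l) -> NoDup G -> incl G F -> list_Rsum g G <= list_Rsum g F.
Proof.
  intros Hg NG I. destruct (incl_perm_app G F NG I) as [H P].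
  rewrite (list_Rsum_perm g _ _ P), list_Rsum_app.
  assert (h := list_Rsum_ge_0 g H Hg). lra.
Qed.

Lemma is_sum_over_norm_bounded (L : R -> Prop) (g : R -> C) (s : C) :
  is_sum_over L g s ->
  exists A : R, forall G : list R, NoDup G -> (forall l, In l G -> L l) ->
    list_Rsum (fun l => Cmod (g l)) G <= A.
Proof.
  intros Hg.
  destruct (is_sum_over_tail L g s nil 1 Hg) as [F [NF [_ [LF HF]]]];
    [easy | lra |].
  exists (list_Rsum (fun l => Cmod (g l)) F + 1).
  intros G NG LG.
  assert (IG : incl F (nodup Req_EM_T (F ++ G))).
  { intros l Hl; apply nodup_In, in_or_app; now left. }
  destruct (incl_perm_app F _ NF IG) as [H P].
  apply Rle_trans with (list_Rsum (fun l => Cmod (g l)) (nodup Req_EM_T (F ++ G))).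
  - apply list_Rsum_incl; [intros; apply Cmod_ge_0 | easy |].
    intros l Hl; apply nodup_In, in_or_app; now right.
  - rewrite (list_Rsum_perm _ _ _ P), list_Rsum_app.
    apply Rplus_le_compat_l, HF.
    + apply (Permutation_NoDup P), NoDup_nodup.
    + intros l Hl.
      assert (Hi : In l (nodup Req_EM_T (F ++ G))).
      { apply (Permutation_in _ (Permutation_sym P)), in_or_app; now right. }
      apply nodup_In, in_app_or in Hi; destruct Hi; auto.
Qed.

(** The tail bound is a hypothesis on moduli only, so it can be carried over from another point at
    which the terms have the same moduli. *)
Lemma sum_approx_of_tail (L : R -> Prop) (g : R -> C) (s : C) (F : list R) (eps : R) :
  is_sum_over L g s -> NoDup F -> (forall l, In l F -> L l) ->
  (forall H : list R, NoDup (F ++ H) -> (forall l, In l H -> L l) ->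
      list_Rsum (fun l => Cmod (g l)) H <= eps) ->
  Cmod (list_Csum g F - s) <= eps.
Proof.
  intros Hg NF LF HF. apply Rnot_lt_le. intros Hlt.
  assert (Hd : 0 < Cmod (list_Csum g F - s) - eps) by lra.
  destruct (Hg (mkposreal _ Hd)) as [F1 [LF1 Hs]]; simpl in Hs.
  assert (IG : incl F (nodup Req_EM_T (F ++ F1))).
  { intros l Hl; apply nodup_In, in_or_app; now left. }
  assert (LG : forall l, In l (nodup Req_EM_T (F ++ F1)) -> L l).
  { intros l Hl; apply nodup_In, in_app_or in Hl; destruct Hl; auto. }
  destruct (incl_perm_app F _ NF IG) as [H P].
  assert (K : Cmod (list_Csum g (nodup Req_EM_T (F ++ F1)) - s)
              < Cmod (list_Csum g F - s) - eps).
  { apply Hs; [apply NoDup_nodup | easy |].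
    intros l Hl; apply nodup_In, in_or_app; now right. }
  assert (K2 : list_Rsum (fun l => Cmod (g l)) H <= eps).
  { apply HF.
    - apply (Permutation_NoDup P), NoDup_nodup.
    - intros l Hl; apply LG, (Permutation_in _ (Permutation_sym P)), in_or_app; now right. }
  rewrite (list_Csum_perm _ _ _ P), list_Csum_app in K.
  assert (K3 := Cmod_list_Csum_le g H).
  assert (K4 := Cmod_minus_triangle (list_Csum g F) (list_Csum g F + list_Csum g H) s).
  replace (list_Csum g F - (list_Csum g F + list_Csum g H))%C
    with (- list_Csum g H)%C in K4 by ring.
  rewrite Cmod_opp in K4. lra.
Qed.

(** * Characters and extraction of Fourier coefficients *)

Definition cis (t : R) : C := (cos t, sin t).

Lemma Cmod_cis (t : R) : Cmod (cis t) = 1.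
Proof.
  unfold Cmod, cis; simpl. assert (h := sin2_cos2 t). unfold Rsqr in h.
  replace (_ + _) with 1 by lra. apply sqrt_1.
Qed.

Lemma cis_add (s t : R) : (cis s * cis t)%C = cis (s + t).
Proof.
  unfold cis, Cmult; simpl. rewrite cos_plus, sin_plus. f_equal; ring.
Qed.

Lemma e2pii_pair (l x y : R) :
  e2pii (RtoC l * (x, y))%C = (RtoC (exp (- (2 * PI * l * y))) * cis (2 * PI * l * x))%C.
Proof.
  unfold e2pii, Cexp.
  replace (RtoC (2 * PI) * Ci * (RtoC l * (x, y)))%C
    with (- (2 * PI * l * y), 2 * PI * l * x); [reflexivity|].
  unfold Ci, Cmult, RtoC; simpl. f_equal; ring.
Qed.

Lemma Cmod_RtoC_exp (t : R) : Cmod (RtoC (exp t)) = exp t.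
Proof. rewrite Cmod_R. apply Rabs_pos_eq, Rlt_le, exp_pos. Qed.

Lemma Cmod_e2pii (l x y : R) :
  Cmod (e2pii (RtoC l * (x, y))%C) = exp (- (2 * PI * l * y)).
Proof.
  rewrite e2pii_pair, Cmod_mult, Cmod_cis, Cmod_RtoC_exp. ring.
Qed.

Lemma Lambda_sub_int (u : C) (l l' : R) :
  Lambda u l -> Lambda u l' -> exists n : Z, l - l' = IZR n.
Proof.
  unfold Lambda; intros H H'. rewrite <- H' in H; clear H'.
  assert (K : forall t, e2pii (RtoC t) = cis (2 * PI * t)).
  { intros t. replace (RtoC t) with (RtoC t * (1, 0))%C
      by (unfold RtoC, Cmult; simpl; f_equal; ring).
    rewrite e2pii_pair. replace (- (2 * PI * t * 0)) with 0 by ring.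
    rewrite exp_0. replace (2 * PI * t * 1) with (2 * PI * t) by ring. ring. }
  rewrite !K in H. unfold cis in H. injection H as Hc Hs.
  assert (C1 : cos (2 * (PI * (l - l'))) = 1).
  { replace (2 * (PI * (l - l'))) with (2 * PI * l - 2 * PI * l') by ring.
    rewrite cos_minus, Hc, Hs. assert (h := sin2_cos2 (2 * PI * l')).
    unfold Rsqr in h. lra. }
  rewrite cos_2a_sin in C1.
  assert (S0 : sin (PI * (l - l')) = 0) by nra.
  destruct (sin_eq_0_0 _ S0) as [n Hn].
  exists n. apply (Rmult_eq_reg_l PI); [|apply PI_neq0]. lra.
Qed.

Lemma sin_IZR_PI (n : Z) : sin (IZR n * PI) = 0.
Proof. apply sin_eq_0_1. now exists n. Qed.

(** Orthogonality of characters, expressed by a primitive. Two exponents in [Lambda u] differ by an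
    integer n; for n nonzero the primitive has equal values at both ends, because sin(n pi) = 0 and
    the cosine is even. *)
Lemma fourier_term (u : C) (kc : C) (l lam y : R) :
  Lambda u l -> Lambda u lam ->
  exists A : R -> R,
    (forall x, is_derive A x
       (Re (kc * e2pii (RtoC l * (x, y)) * cis (- (2 * PI * lam * x)))%C)) /\
    (l <> lam -> A (1/2) - A (- (1/2)) = 0) /\
    (l = lam -> A (1/2) - A (- (1/2)) = Re kc * exp (- (2 * PI * lam * y))).
Proof.
  intros Hl Hlam.
  destruct (Lambda_sub_int u l lam Hl Hlam) as [n Hn].
  destruct kc as [p q].
  assert (E : forall x, Re ((p, q) * e2pii (RtoC l * (x, y)) * cis (- (2 * PI * lam * x)))%C
     = exp (- (2 * PI * l * y)) * (p * cos (2 * (IZR n * PI) * x) - q * sin (2 * (IZR n * PI) * x))).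
  { intros x. rewrite e2pii_pair.
    replace ((p, q) * (RtoC (exp (- (2 * PI * l * y))) * cis (2 * PI * l * x)) *
             cis (- (2 * PI * lam * x)))%C
      with (RtoC (exp (- (2 * PI * l * y))) * ((p, q) *
             (cis (2 * PI * l * x) * cis (- (2 * PI * lam * x)))))%C by ring.
    rewrite cis_add.
    replace (2 * PI * l * x + - (2 * PI * lam * x)) with (2 * (IZR n * PI) * x)
      by (rewrite <- Hn; ring).
    rewrite re_scal_l. reflexivity. }
  destruct (Req_dec l lam) as [El|El].
  - exists (fun x => x * (exp (- (2 * PI * l * y)) * p)).
    assert (Hn0 : IZR n = 0) by lra.
    split; [|split; [easy|]].
    + intros x. rewrite E, Hn0.
      replace (2 * (0 * PI) * x) with 0 by ring. rewrite cos_0, sin_0.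
      auto_derive; [easy|ring].
    + intros _. subst l. simpl. lra.
  - exists (fun x => exp (- (2 * PI * l * y)) *
        (p * sin (2 * (IZR n * PI) * x) + q * cos (2 * (IZR n * PI) * x)) / (2 * (IZR n * PI))).
    assert (HPI := PI_RGT_0).
    assert (Hn0 : IZR n <> 0) by lra.
    split; [|split; [|easy]].
    + intros x. rewrite E. auto_derive; [easy|field].
      split; [lra|easy].
    + intros _.
      replace (2 * (IZR n * PI) * (1/2)) with (IZR n * PI) by field.
      replace (2 * (IZR n * PI) * - (1/2)) with (- (IZR n * PI)) by field.
      rewrite sin_neg, cos_neg, sin_IZR_PI. field. split; [lra|easy].
Qed.

Lemma fourier_sum (u : C) (a : R -> C) (kap : C) (lam y : R) (F : list R) :
  Lambda u lam -> NoDup F -> (forall l, In l F -> Lambda u l) ->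
  exists A : R -> R,
    (forall x, is_derive A x
       (Re (kap * list_Csum (fun l => a l * e2pii (RtoC l * (x, y)))%C F
            * cis (- (2 * PI * lam * x)))%C)) /\
    (~ In lam F -> A (1/2) - A (- (1/2)) = 0) /\
    (In lam F -> A (1/2) - A (- (1/2)) = Re (kap * a lam)%C * exp (- (2 * PI * lam * y))).
Proof.
  intros Hlam NF LF. induction NF as [|l F Hl NF IH].
  - exists (fun _ => 0). split; [|split; [intros; ring|easy]].
    intros x. simpl.
    match goal with |- is_derive _ _ ?d => replace d with 0 by ring end.
    apply (is_derive_const (K := R_AbsRing) (V := R_NormedModule) 0 x).
  - destruct IH as [A [HA [HA0 HA1]]]; [intros; apply LF; now right|].
    destruct (fourier_term u (kap * a l) l lam y) as [B [HB [HB0 HB1]]];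
      [apply LF; now left | easy |].
    exists (fun x => B x + A x). split; [|split].
    + intros x. rewrite list_Csum_cons.
      match goal with |- is_derive _ _ (Re ?X) =>
        replace X with (kap * a l * e2pii (RtoC l * (x, y)) * cis (- (2 * PI * lam * x)) +
          kap * list_Csum (fun l => a l * e2pii (RtoC l * (x, y)))%C F
            * cis (- (2 * PI * lam * x)))%C by ring end.
      rewrite re_plus. apply (is_derive_plus B A x _ _ (HB x) (HA x)).
    + intros Hi. assert (l <> lam) by (intros ->; apply Hi; now left).
      assert (~ In lam F) by (intros h; apply Hi; now right).
      rewrite <- (Rplus_0_r 0), <- (HB0 H) at 1. rewrite <- (HA0 H0). ring.
    + intros Hi. destruct (Req_dec l lam) as [El|El].
      * assert (~ In lam F) by congruence. rewrite <- El at 1.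
        assert (h := HB1 El). assert (h' := HA0 H). rewrite El. rewrite El in h. lra.
      * destruct Hi as [Hi|Hi]; [easy|].
        assert (h := HB0 El). assert (h' := HA1 Hi). lra.
Qed.

(** The modulus of e(l z) depends only on Im z, so a set [F] found at x = 0 serves the whole
    horizontal line. *)
Lemma expansion_tail (f : C -> C) (u : C) (a : R -> C) (y : R) (F0 : list R) (eps : R) :
  has_expansion f u a -> 0 < y -> (forall l, In l F0 -> Lambda u l) -> 0 < eps ->
  exists F : list R, NoDup F /\ incl F0 F /\ (forall l, In l F -> Lambda u l) /\
    forall x : R,
      Cmod (list_Csum (fun l => a l * e2pii (RtoC l * (x, y)))%C F - f (x, y))%C <= eps.
Proof.
  intros Hf Hy H0 He.
  destruct (is_sum_over_tail _ _ _ F0 eps (Hf (0, y) Hy) H0 He) as [F [NF [IF [LF HF]]]].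
  exists F. repeat split; auto. intros x.
  apply (sum_approx_of_tail (Lambda u) _ _ F eps (Hf (x, y) Hy)); auto.
  intros H NH LH. eapply Rle_trans; [|apply (HF H NH LH)].
  apply Req_le, list_Rsum_ext. intros l. now rewrite !Cmod_mult, !Cmod_e2pii.
Qed.

(* Only a minorant of the integrand with an explicit primitive is needed, so
   that the coefficient formula reduces to the mean value theorem. *)
Lemma coefficient_lower_bound (f : C -> C) (u : C) (a : R -> C) (lam y : R) (kap : C)
    (P L : R -> R) :
  has_expansion f u a -> Lambda u lam -> 0 < y ->
  (forall x, 0 <= x <= 1/2 -> is_derive P x (L x)) ->
  (forall x, 0 <= x <= 1/2 ->
     L x <= Re (kap * f (x, y) * cis (- (2 * PI * lam * x)))%C /\
     L x <= Re (kap * f ((- x)%R, y) * cis (- (2 * PI * lam * - x)))%C) ->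
  2 * (P (1/2) - P 0) <= Re (kap * a lam)%C * exp (- (2 * PI * lam * y)).
Proof.
  intros Hf Hlam Hy HP HL. apply le_epsilon. intros eps He.
  set (M := Cmod kap + 1).
  assert (HM : 0 < M) by (unfold M; assert (h := Cmod_ge_0 kap); lra).
  destruct (expansion_tail f u a y (lam :: nil) (eps / M) Hf Hy) as [F [NF [IF [LF HF]]]].
  { intros l [<-|[]]; easy. }
  { now apply Rdiv_lt_0_compat. }
  destruct (fourier_sum u a kap lam y F Hlam NF LF) as [A [HA [_ HA1]]].
  assert (Hin : In lam F) by (apply IF; now left).
  specialize (HA1 Hin). rewrite <- HA1; clear HA1.
  set (h := fun x => Re (kap * list_Csum (fun l => a l * e2pii (RtoC l * (x, y)))%C F
            * cis (- (2 * PI * lam * x)))%C) in HA.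
  assert (Hh : forall x, Re (kap * f (x, y) * cis (- (2 * PI * lam * x)))%C <= h x + eps).
  { intros x. unfold h.
    match goal with |- Re ?X <= Re ?Y + eps =>
      assert (K : Cmod (X - Y)%C <= eps); [|
        assert (K1 := re_le_Cmod (X - Y)%C); apply Rabs_le_between in K1;
        unfold Cminus in K1 at 2 3; rewrite re_plus, re_opp in K1; lra] end.
    match goal with |- Cmod ?X <= _ => replace X with
      (kap * (f (x, y) - list_Csum (fun l => a l * e2pii (RtoC l * (x, y)))%C F) *
       cis (- (2 * PI * lam * x)))%C by ring end.
    rewrite !Cmod_mult, Cmod_cis, Rmult_1_r, Cmod_minus_sym.
    assert (K := HF x). assert (K0 := Cmod_ge_0 kap).
    apply Rle_trans with (M * (eps / M)); [|apply Req_le; field; lra].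
    apply Rmult_le_compat; auto; [apply Cmod_ge_0 | unfold M; lra]. }
  (* Folding the segment at 0 lets a minorant in |x| be smooth on [0, 1/2]. The derivative of [Q] is
     nonnegative there, the term [2 * eps * x] paying for the two truncation errors. *)
  set (Q := fun x => A x - A (- x) - 2 * P x + 2 * eps * x).
  assert (DQ : forall x, 0 <= x <= 1/2 -> is_derive Q x (h x + h (- x) - 2 * L x + 2 * eps)).
  { intros x Hx. unfold Q.
    assert (H1 := HA x). assert (H2 := HA (- x)). assert (H3 := HP x Hx).
    fold (h x) in H1. fold (h (- x)) in H2.
    auto_derive.
    - repeat split; eexists; eassumption.
    - replace (Derive (fun x0 => A x0) x) with (h x) by (symmetry; now apply is_derive_unique).
      replace (Derive (fun x0 => A x0) (- x)) with (h (- x)) by (symmetry; now apply is_derive_unique).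
      replace (Derive (fun x0 => P x0) x) with (L x) by (symmetry; now apply is_derive_unique).
      ring. }
  destruct (MVT_gen Q 0 (1/2) (fun x => h x + h (- x) - 2 * L x + 2 * eps)) as [c [Hc HQ]].
  - rewrite Rmin_left, Rmax_right by lra. intros x Hx; apply DQ; lra.
  - rewrite Rmin_left, Rmax_right by lra. intros x Hx.
    apply continuity_pt_filterlim.
    apply (ex_derive_continuous (K := R_AbsRing) (V := R_NormedModule)).
    eexists; now apply DQ.
  - rewrite Rmin_left, Rmax_right in Hc by lra.
    destruct (HL c Hc) as [L1 L2].
    assert (h1 := Hh c). assert (h2 := Hh (- c)).
    unfold Q in HQ. rewrite Ropp_0 in HQ. nra.
Qed.

(** The difference is an expansion of 0, and the coefficient bound with minorant 0 gives Re(kap d)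
    >= 0 for every complex kap; the values 1, -1, i, -i force d = 0. This is needed because
    [finite_order] brings its own coefficients. *)
Lemma expansion_unique (f : C -> C) (u : C) (a b : R -> C) (lam : R) :
  has_expansion f u a -> has_expansion f u b -> Lambda u lam -> a lam = b lam.
Proof.
  intros Ha Hb Hlam.
  assert (Hd : has_expansion (fun _ => RtoC 0) u (fun l => a l - b l)%C).
  { intros z Hz eps.
    destruct (Ha z Hz (pos_div_2 eps)) as [Fa [LFa HFa]].
    destruct (Hb z Hz (pos_div_2 eps)) as [Fb [LFb HFb]].
    exists (Fa ++ Fb). split.
    - intros l Hl; apply in_app_or in Hl; destruct Hl; auto.
    - intros G NG LG IG.
      assert (Ka := HFa G NG LG (fun l h => IG l (in_or_app _ _ _ (or_introl h)))).
      assert (Kb := HFb G NG LG (fun l h => IG l (in_or_app _ _ _ (or_intror h)))).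
      simpl in Ka, Kb.
      replace (list_Csum (fun l => (a l - b l) * e2pii (RtoC l * z))%C G - 0)%C with
        ((list_Csum (fun l => a l * e2pii (RtoC l * z))%C G - f z) -
         (list_Csum (fun l => b l * e2pii (RtoC l * z))%C G - f z))%C.
      + eapply Rle_lt_trans; [apply Cmod_triangle|]. rewrite Cmod_opp. lra.
      + clear. induction G as [|l G IH]; simpl; [ring|].
        replace (list_Csum (fun l0 => (a l0 - b l0) * e2pii (RtoC l0 * z))%C G) with
         (list_Csum (fun l0 => (a l0 - b l0) * e2pii (RtoC l0 * z))%C G - 0)%C by ring.
        rewrite <- IH. ring. }
  assert (K : forall kap, 0 <= Re (kap * (a lam - b lam))%C).
  { intros kap.
    assert (h := coefficient_lower_bound _ u _ lam 1 kap (fun _ => 0) (fun _ => 0) Hd Hlam Rlt_0_1).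
    assert (E := exp_pos (- (2 * PI * lam * 1))).
    apply Rnot_lt_le; intros Hlt.
    assert (2 * (0 - 0) <= Re (kap * (a lam - b lam))%C * exp (- (2 * PI * lam * 1))); [|nra].
    apply h.
    - intros x _. apply (is_derive_const (K := R_AbsRing) (V := R_NormedModule) 0 x).
    - intros x _. split; rewrite Cmult_0_r, Cmult_0_l; simpl; lra. }
  set (d := (a lam - b lam)%C) in K.
  assert (Hz : d = RtoC 0).
  { assert (K1 := K 1%C). assert (K2 := K (- (1))%C). assert (K3 := K Ci). assert (K4 := K (- Ci)%C).
    destruct d as [p q]; simpl in *. unfold RtoC; f_equal; lra. }
  replace (a lam) with (d + b lam)%C by (unfold d; ring). rewrite Hz; ring.
Qed.

(** * Automorphy factors of known modulus *)

Lemma Cmod_pair_sqr (x y : R) : Cmod (x, y) * Cmod (x, y) = x * x + y * y.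
Proof.
  assert (h := Cmod2_alt (x, y)). simpl in h. lra.
Qed.

Lemma Cmod_pair_ge (x y : R) : 0 < y -> y <= Cmod (x, y).
Proof.
  intros Hy. assert (h := Rabs_Im_le_Cmod (x, y)). simpl in h.
  rewrite Rabs_pos_eq in h; lra.
Qed.

(** Passage to real functions of a real variable, for which the mean value theorem is available;
    [kap] selects the real-linear projection, for instance 1 for the real and -i for the imaginary
    part. *)
Lemma complex_derive_directional (F : C -> C) (p e l kap : C) (s : R) :
  @is_derive C_AbsRing C_NormedModule F (p + RtoC s * e)%C l ->
  is_derive (fun t : R => Re (kap * F (p + RtoC t * e))%C) s (Re (kap * l * e)%C).
Proof.
  intros [_ Hd].
  specialize (Hd (p + RtoC s * e)%C (fun P H => H)).
  apply is_derive_Reals. intros eps He.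
  set (M := Cmod kap * Cmod e + 1).
  assert (K0 := Cmod_ge_0 kap). assert (E0 := Cmod_ge_0 e).
  assert (HM : 0 < M) by (unfold M; nra).
  assert (HeM : 0 < eps / M) by now apply Rdiv_lt_0_compat.
  destruct (Hd (mkposreal _ HeM)) as [d Hball]; simpl in Hball.
  assert (Hd' : 0 < d / (Cmod e + 1)).
  { apply Rdiv_lt_0_compat; [apply cond_pos | lra]. }
  exists (mkposreal _ Hd'). intros h Hh Hhd; simpl in Hhd.
  assert (Hne : 0 < Rabs h) by now apply Rabs_pos_lt.
  assert (B : Cmod (F (p + RtoC (s + h) * e) - F (p + RtoC s * e) - (RtoC h * e) * l)%C
              <= eps / M * (Rabs h * Cmod e)).
  { assert (Hx : ((p + RtoC (s + h) * e) - (p + RtoC s * e) = RtoC h * e)%C)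
      by (rewrite RtoC_plus; ring).
    rewrite <- Cmod_R, <- Cmod_mult, <- Hx.
    apply (Hball (p + RtoC (s + h) * e)%C).
    change (Cmod ((p + RtoC (s + h) * e) - (p + RtoC s * e))%C < d).
    rewrite Hx, Cmod_mult, Cmod_R.
    apply (Rmult_lt_compat_r (Cmod e + 1)) in Hhd; [|lra].
    replace (d / (Cmod e + 1) * (Cmod e + 1)) with (pos d) in Hhd by (field; lra).
    nra. }
  replace ((Re (kap * F (p + RtoC (s + h) * e))%C - Re (kap * F (p + RtoC s * e))%C) / h -
           Re (kap * l * e)%C)
    with (Re (kap * (F (p + RtoC (s + h) * e) - F (p + RtoC s * e) - (RtoC h * e) * l))%C / h).
  2:{ destruct kap, l, e, (F (p + RtoC (s + h) * _)%C), (F (p + RtoC s * _)%C).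
      unfold Re, RtoC, Cminus, Cplus, Copp, Cmult; simpl. now field. }
  unfold Rdiv. rewrite Rabs_mult, Rabs_inv.
  apply (Rmult_lt_reg_r (Rabs h)); [easy|].
  rewrite Rmult_assoc, Rinv_l, Rmult_1_r by lra.
  eapply Rle_lt_trans; [apply re_le_Cmod|]. rewrite Cmod_mult.
  apply Rle_lt_trans with (Cmod kap * (eps / M * (Rabs h * Cmod e))).
  - now apply Rmult_le_compat_l.
  - replace (Cmod kap * (eps / M * (Rabs h * Cmod e)))
      with ((M - 1) * (eps / M * Rabs h)) by (unfold M; ring).
    replace (eps * Rabs h) with (M * (eps / M * Rabs h)) by (field; lra).
    assert (0 < eps / M * Rabs h) by now apply Rmult_lt_0_compat.
    nra.
Qed.

Lemma Rpower_Cmod_sqr (k x y : R) : 0 < y ->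
  Rpower (Cmod (x, y)) k * Rpower (Cmod (x, y)) k = exp (k * ln (x * x + y * y)).
Proof.
  intros Hy. assert (h := Cmod_pair_ge x y Hy).
  rewrite Rpower_mult_distr by lra. now rewrite Cmod_pair_sqr.
Qed.

(* Differentiating |J|^2 = |z|^(2k) in every direction e gives
   conj(J) J' = k |z|^(2k-2) conj(z) by the Cauchy-Riemann equations; testing
   against e = conj(conj(J) J') yields the bound without solving for J'. *)
Lemma automorphy_derivative_bound (J : C -> C) (k x y : R) (l : C) :
  0 <= k -> 0 < y ->
  (forall z, UHP z -> Cmod (J z) = Rpower (Cmod z) k) ->
  @is_derive C_AbsRing C_NormedModule J (x, y) l ->
  Cmod l <= k * Rpower (Cmod (x, y)) k / Cmod (x, y).
Proof.
  intros Hk Hy HJ Hl.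
  set (z := (x, y) : C).
  assert (Hr := Cmod_pair_ge x y Hy). fold z in Hr.
  assert (Hr2 := Cmod_pair_sqr x y). fold z in Hr2.
  assert (HP : 0 < Rpower (Cmod z) k) by apply exp_pos.
  assert (HJz : Cmod (J z) = Rpower (Cmod z) k) by now apply HJ.
  set (D := (Cconj (J z) * l)%C).
  assert (Key : forall e : C,
     Re (D * e)%C = k * (Rpower (Cmod z) k * Rpower (Cmod z) k)
                      / (Cmod z * Cmod z) * (x * Re e + y * Im e)).
  { intros e.
    assert (Hz : (z + RtoC 0 * e)%C = z) by ring.
    assert (D1 := complex_derive_directional J z e l 1%C 0).
    assert (D2 := complex_derive_directional J z e l (- Ci)%C 0).
    rewrite Hz in D1, D2. specialize (D1 Hl). specialize (D2 Hl).
    set (g1 := fun t : R => Re (1 * J (z + RtoC t * e))%C) in D1.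
    set (g2 := fun t : R => Re (- Ci * J (z + RtoC t * e))%C) in D2.
    assert (DA : is_derive (fun t => g1 t * g1 t + g2 t * g2 t) 0 (2 * Re (D * e)%C)).
    { auto_derive.
      - repeat split; eexists; eassumption.
      - replace (Derive (fun x0 => g1 x0) 0) with (Re (1 * l * e)%C)
          by (symmetry; now apply is_derive_unique).
        replace (Derive (fun x0 => g2 x0) 0) with (Re (- Ci * l * e)%C)
          by (symmetry; now apply is_derive_unique).
        unfold g1, g2, D. rewrite Hz. destruct (J z), l, e. simpl. ring. }
    assert (DB : is_derive (fun t => exp (k * ln ((x + t * Re e) * (x + t * Re e)
                   + (y + t * Im e) * (y + t * Im e)))) 0
              (exp (k * ln (x * x + y * y)) * (k * (/ (x * x + y * y) *
                 (2 * (x * Re e + y * Im e)))))).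
    { auto_derive.
      - rewrite !Rmult_0_l, !Rplus_0_r. nra.
      - rewrite !Rmult_0_l, !Rplus_0_r. field. nra. }
    assert (DC : is_derive (fun t => g1 t * g1 t + g2 t * g2 t) 0
              (exp (k * ln (x * x + y * y)) * (k * (/ (x * x + y * y) *
                 (2 * (x * Re e + y * Im e)))))).
    { apply (is_derive_ext_loc (K := R_AbsRing) (V := R_NormedModule)) with (2 := DB).
      (* The formula for |J| holds only in the upper half plane; this radius keeps [y + t * Im e]
         positive. *)
      assert (Hd : 0 < y / (Rabs (Im e) + 1)).
      { apply Rdiv_lt_0_compat; [easy|]. assert (h := Rabs_pos (Im e)); lra. }
      exists (mkposreal _ Hd). intros t Ht.
      change (Rabs (t - 0) < y / (Rabs (Im e) + 1)) in Ht. rewrite Rminus_0_r in Ht.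
      assert (Hpos : 0 < y + t * Im e).
      { assert (h := Rabs_pos (Im e)). assert (h2 := Rabs_pos t).
        apply (Rmult_lt_compat_r (Rabs (Im e) + 1)) in Ht; [|lra].
        replace (y / (Rabs (Im e) + 1) * (Rabs (Im e) + 1)) with y in Ht by (field; lra).
        assert (h3 := Rabs_mult t (Im e)). assert (h4 := Rle_abs (- (t * Im e))).
        rewrite Rabs_Ropp in h4. nra. }
      assert (Hw : (z + RtoC t * e)%C = (x + t * Re e, y + t * Im e)).
      { unfold z; destruct e; unfold RtoC, Cmult, Cplus; simpl. f_equal; ring. }
      rewrite <- Rpower_Cmod_sqr by easy. rewrite <- Hw, <- HJ by (rewrite Hw; easy).
      assert (K := Cmod2_alt (J (z + RtoC t * e)%C)).
      unfold g1, g2. destruct (J (z + RtoC t * e)%C) as [a b]. simpl in *. lra. }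
    assert (U := is_derive_unique _ _ _ DA). rewrite (is_derive_unique _ _ _ DC) in U.
    unfold z at 1 2. rewrite Rpower_Cmod_sqr by easy. rewrite Hr2.
    apply (Rmult_eq_reg_l 2); [|lra]. rewrite <- U. field. nra. }
  specialize (Key (Cconj D)).
  assert (HD : Re (D * Cconj D)%C = Cmod D * Cmod D).
  { assert (h := Cmod2_alt D). destruct D; simpl in *. lra. }
  rewrite HD in Key.
  assert (CS : x * Re (Cconj D) + y * Im (Cconj D) <= Cmod z * Cmod D).
  { replace (x * Re (Cconj D) + y * Im (Cconj D)) with (Re (Cconj z * Cconj D)%C)
      by (unfold z; destruct D; simpl; ring).
    rewrite <- (Cmod_conj z), <- (Cmod_conj D), <- Cmod_mult.
    eapply Rle_trans; [apply Rle_abs | apply re_le_Cmod]. }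
  assert (HDl : Cmod D = Rpower (Cmod z) k * Cmod l).
  { unfold D. now rewrite Cmod_mult, Cmod_conj, HJz. }
  assert (Hl0 := Cmod_ge_0 l).
  set (r := Cmod z) in *. set (p := Rpower r k) in *.
  assert (Hrp : 0 < r) by lra.
  apply Rnot_lt_le. intros Hlt.
  assert (0 <= k * p / r).
  { apply Rmult_le_pos; [nra | apply Rlt_le, Rinv_0_lt_compat; lra]. }
  assert (0 < Cmod D) by (rewrite HDl; nra).
  assert (Key2 : Cmod D * Cmod D <= k * p * p / r * Cmod D).
  { rewrite Key. apply Rle_trans with (k * (p * p) / (r * r) * (r * Cmod D)).
    - apply Rmult_le_compat_l; [|easy].
      apply Rmult_le_pos; [nra|]. apply Rlt_le, Rinv_0_lt_compat; nra.
    - apply Req_le. field. lra. }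
  apply Rmult_le_reg_r in Key2; [|easy].
  rewrite HDl in Key2.
  replace (k * p * p / r) with (p * (k * p / r)) in Key2 by (field; lra).
  apply Rmult_le_reg_l in Key2; lra.
Qed.

Lemma Cmod_pair_le_abs (c x y : R) : Rabs c <= Rabs x -> Cmod (c, y) <= Cmod (x, y).
Proof.
  intros H. unfold Cmod. apply sqrt_le_1_alt. simpl.
  assert (h := Rsqr_le_abs_1 _ _ H). unfold Rsqr in h. lra.
Qed.

(** The mean value theorem fails for complex values, so it is applied to the projection of J onto
    the increment [w] itself, whose total change is |w|^2. Since k >= 0, the power |(c, y)|^k at the
    intermediate point is at most |(x, y)|^k; after division by |J(x, y)| a relative error k |x| / y
    remains. *)
Lemma automorphy_lipschitz (J : C -> C) (k x y : R) :
  0 <= k -> 0 < y -> holomorphic_on_UHP J ->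
  (forall z, UHP z -> Cmod (J z) = Rpower (Cmod z) k) ->
  Cmod (J (x, y) - J (0, y))%C <= k * Rabs x / y * Rpower (Cmod (x, y)) k.
Proof.
  intros Hk Hy Hhol HJ.
  set (w := (J (x, y) - J (0%R, y))%C).
  set (g := fun s : R => Re (Cconj w * J ((0%R, y) + RtoC s * 1))%C).
  assert (Hp : forall s : R, ((0%R, y) + RtoC s * 1)%C = (s, y)).
  { intros s. unfold RtoC, Cmult, Cplus; simpl. f_equal; ring. }
  assert (Dg : forall s, exists l, Cmod l <= k * Rpower (Cmod (s, y)) k / Cmod (s, y) /\
               is_derive g s (Re (Cconj w * l)%C)).
  { intros s. destruct (Hhol (s, y) Hy) as [l Hl]. exists l. split.
    - now apply (automorphy_derivative_bound J).
    - replace (Cconj w * l)%C with (Cconj w * l * 1)%C by ring.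
      apply complex_derive_directional. now rewrite Hp. }
  destruct (MVT_gen g 0 x (Derive g)) as [c [Hc Hg]].
  - intros s _. destruct (Dg s) as [l [_ Hl]]. apply Derive_correct. eexists; eassumption.
  - intros s _. destruct (Dg s) as [l [_ Hl]]. apply continuity_pt_filterlim.
    apply (ex_derive_continuous (K := R_AbsRing) (V := R_NormedModule)).
    eexists; eassumption.
  - destruct (Dg c) as [l [Hlb Hl]]. rewrite (is_derive_unique _ _ _ Hl) in Hg.
    assert (Hcx : Rabs c <= Rabs x).
    { unfold Rmin, Rmax in Hc. destruct (Rle_dec 0 x).
      - rewrite !Rabs_pos_eq; lra.
      - rewrite !Rabs_left1; lra. }
    assert (Hw : g x - g 0 = Cmod w * Cmod w).
    { unfold g. rewrite !Hp. assert (h := Cmod2_alt w).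
      replace (Cmod w * Cmod w) with (Cmod w ^ 2) by ring. rewrite h.
      unfold w. destruct (J (x, y)), (J (0, y)). simpl. ring. }
    rewrite Hw, Rminus_0_r in Hg.
    assert (K1 := re_le_Cmod (Cconj w * l)%C). rewrite Cmod_mult, Cmod_conj in K1.
    assert (Hcy := Cmod_pair_ge c y Hy).
    assert (Hxy := Cmod_pair_le_abs c x y Hcx).
    assert (Hlb2 : Cmod l <= k / y * Rpower (Cmod (x, y)) k).
    { eapply Rle_trans; [apply Hlb|].
      replace (k * Rpower (Cmod (c, y)) k / Cmod (c, y))
        with (k * / Cmod (c, y) * Rpower (Cmod (c, y)) k) by (field; lra).
      apply Rmult_le_compat.
      - apply Rmult_le_pos; [lra | apply Rlt_le, Rinv_0_lt_compat; lra].
      - apply Rlt_le, exp_pos.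
      - apply Rmult_le_compat_l; [lra|]. apply Rinv_le_contravar; lra.
      - apply Rle_Rpower_l; lra. }
    assert (Hw0 := Cmod_ge_0 w). assert (Hl0 := Cmod_ge_0 l). assert (Hx0 := Rabs_pos x).
    assert (Hfin : Cmod w * Cmod w <= Cmod w * Cmod l * Rabs x).
    { rewrite Hg. eapply Rle_trans; [apply Rle_abs|]. rewrite Rabs_mult.
      apply Rmult_le_compat_r; easy. }
    destruct Hw0 as [Hw0|Hw0].
    + rewrite Rmult_assoc in Hfin. apply Rmult_le_reg_l in Hfin; [|easy].
      replace (k * Rabs x / y * Rpower (Cmod (x, y)) k)
        with (k / y * Rpower (Cmod (x, y)) k * Rabs x) by (field; lra).
      eapply Rle_trans; [apply Hfin|]. now apply Rmult_le_compat_r.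
    + rewrite <- Hw0. apply Rmult_le_pos; [|apply Rlt_le, exp_pos].
      apply Rmult_le_pos; [nra | apply Rlt_le, Rinv_0_lt_compat; lra].
Qed.

(** * Growth of a modular function near the real axis *)

Definition inversion_matrix : SL2Z := mkSL2Z 0 (-1) 1 0 eq_refl.

Lemma denom_inversion (z : C) : denom inversion_matrix z = z.
Proof. unfold denom, ZtoC; simpl. ring. Qed.

Lemma moebius_inversion (x y : R) : 0 < y ->
  moebius inversion_matrix (x, y) = (- x / (x * x + y * y), y / (x * x + y * y)).
Proof.
  intros Hy. unfold moebius. rewrite denom_inversion.
  unfold ZtoC, Cdiv, Cinv, RtoC, Cmult, Cplus; simpl.
  f_equal; field; nra.
Qed.

Lemma moebius_translation (x y : R) : moebius translation (x, y) = (x + 1, y).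
Proof.
  unfold moebius, denom, ZtoC; simpl.
  replace (RtoC 0 * (x, y) + RtoC 1)%C with (RtoC 1) by ring.
  unfold Cdiv. replace (/ RtoC 1)%C with (RtoC 1) by (unfold Cinv, RtoC; simpl; f_equal; field).
  unfold RtoC, Cmult, Cplus; simpl. f_equal; ring.
Qed.

Lemma Rpower_1_l (k : R) : Rpower 1 k = 1.
Proof. unfold Rpower. rewrite ln_1, Rmult_0_r. apply exp_0. Qed.

Lemma modular_Cmod_periodic (k : R) (f : C -> C) (j : SL2Z -> C -> C) (x y : R) (n : Z) :
  modular_function k f j -> 0 < y -> Cmod (f (x + IZR n, y)) = Cmod (f (x, y)).
Proof.
  intros [_ [Hj _]] Hy.
  assert (H1 : forall x, Cmod (f (x + 1, y)) = Cmod (f (x, y))).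
  { intros x0. destruct (proj2 (Hj translation) (x0, y) Hy) as [HJ Hf].
    rewrite moebius_translation in Hf. rewrite Hf, Cmod_mult, HJ.
    replace (denom translation (x0, y)) with (RtoC 1)
      by (unfold denom, ZtoC; simpl; ring).
    rewrite Cmod_1, Rpower_1_l. ring. }
  assert (HN : forall (m : nat) x, Cmod (f (x + INR m, y)) = Cmod (f (x, y))).
  { induction m as [|m IH]; intros x0.
    - simpl INR. now rewrite Rplus_0_r.
    - rewrite S_INR, <- Rplus_assoc, H1. apply IH. }
  destruct (Z_le_gt_dec 0 n) as [Hn|Hn].
  - rewrite <- (Z2Nat.id n Hn), <- INR_IZR_INZ. apply HN.
  - rewrite <- (HN (Z.to_nat (- n)) (x + IZR n)).
    rewrite INR_IZR_INZ, Z2Nat.id by lia. rewrite opp_IZR.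
    replace (x + IZR n + - IZR n) with x by ring. easy.
Qed.

Lemma modular_Cmod_inversion (k : R) (f : C -> C) (j : SL2Z -> C -> C) (x y : R) :
  modular_function k f j -> 0 < y ->
  Cmod (f (- x / (x * x + y * y), y / (x * x + y * y))) =
  Rpower (Cmod (x, y)) k * Cmod (f (x, y)).
Proof.
  intros [_ [Hj _]] Hy.
  destruct (proj2 (Hj inversion_matrix) (x, y) Hy) as [HJ Hf].
  rewrite moebius_inversion in Hf by easy.
  now rewrite Hf, Cmod_mult, HJ, denom_inversion.
Qed.

Lemma exp_le_compat (s t : R) : s <= t -> exp s <= exp t.
Proof.
  intros [H|H]; [now apply Rlt_le, exp_increasing | rewrite H; lra].
Qed.

Lemma nearest_integer_shift (x : R) : exists n : Z, Rabs (x + IZR n) <= 1/2.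
Proof.
  exists (- up (x - 1/2))%Z. rewrite opp_IZR.
  destruct (archimed (x - 1/2)). apply Rabs_le. lra.
Qed.

(* One step of the reduction, for -1/z outside the cusp neighbourhood, in the
   quantities r = |z| and v = Im(-1/z) = y / r^2. *)
Lemma inversion_growth_step (k B y r v E Fz : R) :
  0 <= k -> 0 <= B -> 0 < y -> 0 < r <= 1 -> v * (r * r) = y -> 0 < v ->
  Rpower r k * Fz <= B / Rpower v k * E -> 0 <= E ->
  Fz <= B / Rpower y k * E.
Proof.
  intros Hk HB Hy Hr Hv Hv0 H HE.
  rewrite <- Hv, <- !Rpower_mult_distr by (try nra; lra).
  assert (Hp : 0 < Rpower r k) by apply exp_pos.
  assert (Hq : 0 < Rpower v k) by apply exp_pos.
  assert (Hp1 : Rpower r k <= 1).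
  { rewrite <- (Rpower_1_l k). apply Rle_Rpower_l; lra. }
  apply (Rmult_le_reg_l (Rpower r k)); [easy|].
  eapply Rle_trans; [apply H|].
  replace (Rpower r k * (B / (Rpower v k * (Rpower r k * Rpower r k)) * E))
    with (B / Rpower v k * E * / Rpower r k) by (field; lra).
  assert (0 <= B / Rpower v k * E).
  { apply Rmult_le_pos; [|easy]. apply Rmult_le_pos; [easy|].
    now apply Rlt_le, Rinv_0_lt_compat. }
  assert (1 <= / Rpower r k).
  { rewrite <- Rinv_1. now apply Rinv_le_contravar. }
  nra.
Qed.

Lemma modular_growth_bound (k : R) (f : C -> C) (j : SL2Z -> C -> C) (B m : R) :
  0 <= k -> 0 <= B -> 0 <= m -> modular_function k f j ->
  (forall x y, 1/2 <= y -> Cmod (f (x, y)) <= B * exp (2 * PI * m * y)) ->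
  forall x y, 0 < y < 1/2 -> Cmod (f (x, y)) <= B / Rpower y k * exp (2 * PI * m / y).
Proof.
  intros Hk HB Hm Hmod Hhigh.
  assert (HPI := PI_RGT_0).
  (* The integer [n] bounds the number of inversions still needed to reach height 1/2; for [n = 0]
     the hypotheses on [y] contradict each other. *)
  assert (Main : forall (n : nat) x y, 0 < y < 1/2 -> 1/2 <= 2 ^ n * y ->
    Cmod (f (x, y)) <= B / Rpower y k * exp (2 * PI * m / y)).
  { induction n as [|n IH]; intros x0 y Hy Hn; [simpl in Hn; lra|].
    destruct (nearest_integer_shift x0) as [s Hs].
    rewrite <- (modular_Cmod_periodic k f j x0 y s) by easy.
    set (x := x0 + IZR s) in *. clearbody x.
    apply Rabs_le_between in Hs.
    assert (Hinv := modular_Cmod_inversion k f j x y Hmod (proj1 Hy)).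
    set (v := y / (x * x + y * y)) in *.
    assert (Hr2 := Cmod_pair_sqr x y).
    assert (Hry := Cmod_pair_ge x y (proj1 Hy)).
    set (r := Cmod (x, y)) in *.
    (* Here the threshold 1/2 matters: |x| <= 1/2 and y < 1/2 give |z|^2 <= 1/2, so that the
       inversion doubles the height. *)
    assert (Hrr : r * r <= 1/2) by nra.
  assert (Hr1 : r <= 1) by nra.
    assert (Hv : v * (r * r) = y) by (unfold v; rewrite Hr2; field; nra).
    assert (Hv0 : 0 < v) by (unfold v; apply Rdiv_lt_0_compat; nra).
    assert (Hvy : v * y <= 1).
    { apply (Rmult_le_reg_r (r * r)); [nra|].
      replace (v * y * (r * r)) with (y * (v * (r * r))) by ring. rewrite Hv. nra. }
    assert (Hv2 : 2 * y <= v).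
  { assert (0 <= v * (1/2 - r * r)) by (apply Rmult_le_pos; lra). lra. }
    destruct (Rle_dec (1/2) v) as [Hlt|Hge].
    - assert (H := Hhigh (- x / (x * x + y * y)) v Hlt).
      rewrite Hinv in H.
      assert (Hp : 0 < Rpower y k) by apply exp_pos.
      assert (Hpr : Rpower y k <= Rpower r k) by (apply Rle_Rpower_l; lra).
      assert (He : exp (2 * PI * m * v) <= exp (2 * PI * m / y)).
      { apply exp_le_compat. unfold Rdiv. apply Rmult_le_compat_l; [nra|].
        apply (Rmult_le_reg_r y); [easy|]. rewrite Rinv_l; lra. }
      apply (Rmult_le_reg_l (Rpower y k)); [easy|].
      replace (Rpower y k * (B / Rpower y k * exp (2 * PI * m / y)))
        with (B * exp (2 * PI * m / y)) by (field; lra).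
      assert (Hf0 := Cmod_ge_0 (f (x, y))).
      eapply Rle_trans; [apply Rmult_le_compat_r; eassumption|].
      eapply Rle_trans; [apply H|]. now apply Rmult_le_compat_l.
    - apply (inversion_growth_step k B y r v); try lra.
      2: apply Rlt_le, exp_pos.
      rewrite <- Hinv.
      eapply Rle_trans; [apply IH; [lra|] |].
      + simpl in Hn. assert (0 < 2 ^ n) by (apply pow_lt; lra). nra.
      + apply Rmult_le_compat_l.
        * apply Rmult_le_pos; [easy|]. apply Rlt_le, Rinv_0_lt_compat, exp_pos.
        * apply exp_le_compat. unfold Rdiv. apply Rmult_le_compat_l; [nra|].
          apply Rinv_le_contravar; lra. }
  intros x y Hy.
  destruct (Pow_x_infinity 2 (ltac:(rewrite Rabs_pos_eq; lra)) (/ y)) as [n Hn].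
  apply (Main n); [easy|].
  specialize (Hn n (le_n n)). rewrite Rabs_pos_eq in Hn by (apply pow_le; lra).
  assert (/ y * y = 1) by (apply Rinv_l; lra). nra.
Qed.

(* Outside the cusp neighbourhood of 0 the trivial growth rate is halved,
   because one inversion at least doubles the imaginary part. *)
Lemma modular_minor_arc_bound (k : R) (f : C -> C) (j : SL2Z -> C -> C) (B m : R) :
  0 <= k -> 0 <= B -> 0 <= m -> modular_function k f j ->
  (forall x y, 1/2 <= y -> Cmod (f (x, y)) <= B * exp (2 * PI * m * y)) ->
  forall x y, Rabs x <= 1/2 -> 0 < y < 1/2 -> y / (x * x + y * y) < 1/2 ->
  Cmod (f (x, y)) <= B / Rpower y k * exp (PI * m / y).
Proof.
  intros Hk HB Hm Hmod Hhigh x y Hx Hy Hlow.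
  assert (HPI := PI_RGT_0).
  apply Rabs_le_between in Hx.
  assert (Hinv := modular_Cmod_inversion k f j x y Hmod (proj1 Hy)).
  set (v := y / (x * x + y * y)) in *.
  assert (Hr2 := Cmod_pair_sqr x y).
  assert (Hry := Cmod_pair_ge x y (proj1 Hy)).
  set (r := Cmod (x, y)) in *.
  assert (Hrr : r * r <= 1/2) by nra.
  assert (Hr1 : r <= 1) by nra.
  assert (Hv : v * (r * r) = y) by (unfold v; rewrite Hr2; field; nra).
  assert (Hv0 : 0 < v) by (unfold v; apply Rdiv_lt_0_compat; nra).
  assert (Hv2 : 2 * y <= v).
  { assert (0 <= v * (1/2 - r * r)) by (apply Rmult_le_pos; lra). lra. }
  apply (inversion_growth_step k B y r v); try lra.
  2: apply Rlt_le, exp_pos.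
  rewrite <- Hinv.
  eapply Rle_trans; [apply (modular_growth_bound k f j B m); auto; lra|].
  apply Rmult_le_compat_l.
  - apply Rmult_le_pos; [easy|]. apply Rlt_le, Rinv_0_lt_compat, exp_pos.
  - apply exp_le_compat. replace (PI * m / y) with (2 * PI * m * / (2 * y)) by (field; lra).
    unfold Rdiv. apply Rmult_le_compat_l; [nra|]. apply Rinv_le_contravar; lra.
Qed.

(** * Lowest exponent and principal part at infinity *)

Lemma exists_min_in_list (P : R -> Prop) (F : list R) :
  (exists x, P x /\ In x F) ->
  exists x, P x /\ In x F /\ forall x', P x' -> In x' F -> x <= x'.
Proof.
  induction F as [|h F IH]; intros [x [Px Hx]]; [easy|].
  destruct (classic (exists x, P x /\ In x F)) as [E|E].
  - destruct (IH E) as [q [Pq [Iq Mq]]].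
    destruct (classic (P h /\ h <= q)) as [[Ph Hh]|N].
    + exists h. split; [easy|]. split; [now left|].
      intros x' Px' [->|Hx']; [lra|]. specialize (Mq x' Px' Hx'). lra.
    + exists q. split; [easy|]. split; [now right|].
      intros x' Px' [->|Hx']; [|auto].
      apply Rnot_lt_le. intros Hlt. apply N. split; [easy|lra].
  - destruct Hx as [->|Hx]; [|elim E; now exists x].
    exists x. split; [easy|]. split; [now left|].
    intros x' Px' [->|Hx']; [lra|]. elim E; now exists x'.
Qed.

(** The finite order condition concerns some expansion with its own multiplier; evaluation at i
    identifies the multipliers and uniqueness the coefficients. As exponents differ by integers, the
    next one is at least 1 higher. *)
Lemma modular_lowest_exponent (k : R) (f : C -> C) (j : SL2Z -> C -> C) (u : C) (a : R -> C) :
  modular_function k f j -> (forall z, UHP z -> j translation z = u) ->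
  has_expansion f u a ->
  (exists mu, mu < 0 /\ Lambda u mu /\ a mu <> RtoC 0) ->
  exists m, 0 < m /\ Lambda u (- m) /\ a (- m) <> RtoC 0 /\
    forall l, Lambda u l -> a l <> RtoC 0 -> l <> - m -> 1 - m <= l.
Proof.
  intros [_ [_ [u' [a' [Hu' [Ha' [S HS]]]]]]] Hu Ha [mu [Hmu [Lmu Amu]]].
  assert (Hi : UHP Ci) by (unfold UHP; simpl; lra).
  assert (u' = u) by (rewrite <- (Hu Ci Hi); symmetry; auto). subst u'.
  destruct (exists_min_in_list (fun l => Lambda u l /\ l < 0 /\ a l <> RtoC 0) S)
    as [q [[Lq [Hq Aq]] [_ Mq]]].
  - exists mu. split; [easy|]. apply HS; auto.
    now rewrite <- (expansion_unique f u a a' mu).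
  - exists (- q). rewrite Ropp_involutive. split; [lra|]. split; [easy|]. split; [easy|].
    intros l Ll Al Hl.
    assert (Hql : q <= l).
    { destruct (Rlt_dec l 0) as [Hl0|Hl0]; [|lra].
      apply Mq; [easy|]. apply HS; auto.
      now rewrite <- (expansion_unique f u a a' l). }
    destruct (Lambda_sub_int u l q Ll Lq) as [n Hn].
    assert (Hn0 : (0 < n)%Z).
    { apply lt_IZR. rewrite <- Hn. simpl. lra. }
    assert (1 <= IZR n) by (apply (IZR_le 1); lia). lra.
Qed.

(** Absolute convergence at the single height 1/2 suffices: for l >= -m' the passage from 1/2 to y
    multiplies a term by at most exp(2 pi m' y), because (l + m')(y - 1/2) + m'/2 >= 0. *)
Lemma expansion_principal_part_bound (f : C -> C) (u : C) (a : R -> C) (m m' : R) :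
  has_expansion f u a -> Lambda u (- m) -> 0 <= m' ->
  (forall l, Lambda u l -> a l <> RtoC 0 -> l <> - m -> - m' <= l) ->
  exists A, 0 <= A /\ forall x y, 1/2 <= y ->
    Cmod (f (x, y) - a (- m)%R * e2pii (RtoC (- m) * (x, y)))%C <= A * exp (2 * PI * m' * y).
Proof.
  intros Hf Lm Hm' Hl.
  assert (HPI := PI_RGT_0).
  assert (H12 : UHP (0, 1/2)) by (unfold UHP; simpl; lra).
  destruct (is_sum_over_norm_bounded _ _ _ (Hf _ H12)) as [A HA].
  exists A. split; [apply (HA nil); [constructor | easy]|].
  intros x y Hy. apply le_epsilon. intros eps He.
  destruct (expansion_tail f u a y ((- m) :: nil) eps Hf) as [F [NF [IF [LF HF]]]]; try lra.
  { intros l [<-|[]]; easy. }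
  specialize (HF x).
  destruct (incl_perm_app ((- m) :: nil) F) as [H P].
  { constructor; [easy | constructor]. }
  { easy. }
  simpl in P.
  assert (NH := Permutation_NoDup P NF). inversion_clear NH as [|? ? Hin NH'].
  rewrite (list_Csum_perm _ _ _ P), list_Csum_cons in HF.
  assert (LH : forall l, In l H -> Lambda u l).
  { intros l Hl'. apply LF, (Permutation_in _ (Permutation_sym P)). now right. }
  assert (K : Cmod (list_Csum (fun l => a l * e2pii (RtoC l * (x, y)))%C H)
              <= A * exp (2 * PI * m' * y)).
  { eapply Rle_trans; [apply Cmod_list_Csum_le|].
    apply Rle_trans with (list_Rsum (fun l => exp (2 * PI * m' * y) *
      Cmod (a l * e2pii (RtoC l * (0%R, (1/2)%R)))%C) H).
    - apply list_Rsum_le. intros l Hin'.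
      rewrite !Cmod_mult, !Cmod_e2pii.
      destruct (classic (a l = RtoC 0)) as [E|E].
      + rewrite E, Cmod_0. lra.
      + assert (Hlm : - m' <= l).
        { apply Hl; auto. intros ->. easy. }
        replace (exp (2 * PI * m' * y) * (Cmod (a l) * exp (- (2 * PI * l * (1/2)))))
          with (Cmod (a l) * (exp (2 * PI * m' * y) * exp (- (2 * PI * l * (1/2))))) by ring.
        apply Rmult_le_compat_l; [apply Cmod_ge_0|].
        rewrite <- exp_plus. apply exp_le_compat.
        assert (0 <= (l + m') * (y - 1/2)) by (apply Rmult_le_pos; lra).
        assert (0 <= (l + m') * (y - 1/2) + m' * (1/2)) by lra.
        nra.
    - rewrite list_Rsum_scal, (Rmult_comm A).
      apply Rmult_le_compat_l; [apply Rlt_le, exp_pos | now apply HA]. }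
  set (t := (a (- m)%R * e2pii (RtoC (- m) * (x, y)))%C) in *.
  set (sH := list_Csum _ H) in *.
  assert (T := Cmod_minus_triangle (f (x, y)) (t + sH) t).
  rewrite (Cmod_minus_sym (f (x, y)) (t + sH)%C) in T.
  replace (t + sH - t)%C with sH in T by ring. lra.
Qed.

(** * Saddle point estimates for the main term *)

Lemma one_minus_abs_le_cos (t : R) : 1 - Rabs t <= cos t.
Proof.
  assert (H : forall s, 0 <= s -> sin s * sin s <= s).
  { intros s [Hs|<-]; [|rewrite sin_0; lra].
    assert (h1 := SIN_bound s). assert (h2 := sin_lt_x s Hs).
    destruct (Rle_dec 0 (sin s)); [nra|].
    destruct (Rle_dec 1 s); [nra|].
    assert (0 <= sin s); [|lra]. apply sin_ge_0; [lra|].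
    assert (h := PI2_3_2). lra. }
  assert (K : forall s, 0 <= s -> 1 - s <= cos s).
  { intros s Hs. replace s with (2 * (s / 2)) at 2 by field. rewrite cos_2a_sin.
    assert (h := H (s / 2)). lra. }
  unfold Rabs. destruct (Rcase_abs t) as [Ht|Ht].
  - rewrite <- cos_neg. apply K. lra.
  - apply K. lra.
Qed.

(** Cube of s/3 <= exp(s/3). It makes the exponentially small errors comparable with the terms of
    order N^(-2) in [saddle_point_gap_positive]. *)
Lemma exp_opp_le_inv_cube (s : R) : 0 < s -> exp (- s) <= 27 / (s * s * s).
Proof.
  intros Hs.
  assert (H : s / 3 <= exp (s / 3)) by (assert (h := exp_ineq1_le (s / 3)); lra).
  assert (H3 : s * s * s / 27 <= exp s).
  { replace s with (s / 3 + s / 3 + s / 3) at 4 by field. rewrite !exp_plus.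
    replace (s * s * s / 27) with (s / 3 * (s / 3) * (s / 3)) by field.
    repeat apply Rmult_le_compat; try lra. nra. }
  assert (Hp : 0 < s * s * s) by (repeat apply Rmult_lt_0_compat; easy).
  rewrite exp_Ropp. replace (27 / (s * s * s)) with (/ (s * s * s / 27)) by (field; lra).
  apply Rinv_le_contravar; lra.
Qed.

(* With N = m / y and t = |x| / y, the main term has modulus at most
   exp (2 pi N / (1 + t^2)) and phase O(N t^3).  The factor r = [sg * t] turns
   the Gaussian into a function with an elementary primitive, and costs only a
   larger exponent since r <= exp (r^2). *)
Lemma saddle_point_minorant (k N sg t X : R) :
  0 <= k -> 0 <= t -> 0 < sg -> sg * sg = N ->
  exp (2 * PI * N / (1 + t * t)) * (1 - 2 * PI * N * (t * t * t) - k * t) <= X ->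
  - exp (2 * PI * N / (1 + t * t)) <= X ->
  exp (2 * PI * N) * (sg * t * exp (- (9 * N * (t * t)))
     - (k + 2 * PI) * t * exp (- (2 * N * (t * t))) - 2 * exp (- (PI * N))) <= X.
Proof.
  intros Hk Ht Hs HN H1 H2.
  assert (HPI3 : 3 < PI) by (assert (h := PI2_3_2); lra).
  assert (HPI4 := PI_4).
  assert (HN0 : 0 < N) by nra.
  assert (Htt : 0 <= t * t) by nra.
  set (T := t * t) in *.
  assert (HNT : 0 <= N * T) by (apply Rmult_le_pos; lra).
  set (s := T / (1 + T)).
  assert (Hs1 : s * (1 + T) = T) by (unfold s; field; lra).
  assert (Hs0 : 0 <= s) by (unfold s; apply Rmult_le_pos; [easy | apply Rlt_le, Rinv_0_lt_compat; lra]).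
  assert (HsT : s <= T) by nra.
  replace (2 * PI * N / (1 + T)) with (2 * PI * N + - (2 * PI * N * s)) in H1, H2
    by (unfold s; field; lra).
  rewrite exp_plus in H1, H2.
  assert (Hst : 0 <= sg * t) by nra.
  assert (Hr : sg * t <= exp (N * T)).
  { assert (h := exp_ineq1_le (N * T)).
    assert (HNT2 : N * T = (sg * t) * (sg * t)) by (unfold T; rewrite <- HN; ring).
    nra. }
  assert (HE : 0 < exp (2 * PI * N)) by apply exp_pos.
  set (E := exp (2 * PI * N)) in *.
  assert (Hw : sg * t * exp (- (9 * N * T)) <= exp (- (8 * (N * T)))).
  { replace (- (8 * (N * T))) with (N * T + - (9 * N * T)) by ring.
    rewrite exp_plus. apply Rmult_le_compat_r; [apply Rlt_le, exp_pos | easy]. }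
  assert (Hp1 := exp_pos (- (PI * N))).
  assert (Hp2 := exp_pos (- (2 * N * T))).
  assert (Hc : 0 <= (k + 2 * PI) * t) by (apply Rmult_le_pos; lra).
  destruct (Rle_dec t 1) as [Ht1|Ht1].
  (* Near the saddle T/2 <= s <= T, and 3 < PI <= 4 puts [e] between exp(-8NT) and exp(-3NT). The
     exponent 9 of the statement is 8 plus the 1 lost in [Hr]; the exponent 2 is 3 minus the 1 spent
     on NT <= exp(NT). *)
  - assert (HT1 : T <= 1) by (unfold T; nra).
    assert (Hs2 : T / 2 <= s) by nra.
    set (e := exp (- (2 * PI * N * s))) in *.
    assert (He0 : 0 < e) by apply exp_pos.
    assert (HNs : N * s <= N * T) by (apply Rmult_le_compat_l; lra).
    assert (HNs2 : N * T / 2 <= N * s)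
      by (unfold Rdiv; rewrite Rmult_assoc; apply Rmult_le_compat_l; lra).
    assert (Hlow : exp (- (8 * (N * T))) <= e).
    { apply exp_le_compat. assert (PI * (N * s) <= 4 * (N * T)) by (apply Rmult_le_compat; nra).
      lra. }
    assert (Hup : e <= exp (- (3 * (N * T)))).
    { apply exp_le_compat. assert (3 * (N * T / 2) <= PI * (N * s)) by (apply Rmult_le_compat; nra).
      lra. }
    assert (Hup2 : e <= exp (- (2 * N * T))).
    { eapply Rle_trans; [apply Hup|]. apply exp_le_compat. lra. }
    assert (Hup3 : N * T * e <= exp (- (2 * N * T))).
    { replace (- (2 * N * T)) with (N * T + - (3 * (N * T))) by ring. rewrite exp_plus.
      apply Rmult_le_compat; try lra.
      assert (h := exp_ineq1_le (N * T)). lra. }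
    eapply Rle_trans; [|apply H1]. rewrite (Rmult_assoc E e).
    apply Rmult_le_compat_l; [lra|].
    assert (2 * PI * t * (N * T * e) <= 2 * PI * t * exp (- (2 * N * T)))
      by (apply Rmult_le_compat_l; nra).
    assert (k * t * e <= k * t * exp (- (2 * N * T))) by (apply Rmult_le_compat_l; nra).
    replace (e * (1 - 2 * PI * N * (T * t) - k * t))
      with (e - 2 * PI * t * (N * T * e) - k * t * e) by ring.
    lra.
  (* Far from the saddle only the modulus bound [H2] is used. One copy of exp(-PI N) covers the main
     term, the other the positive part of the minorant. *)
  - assert (HT1 : 1 <= T) by (unfold T; nra).
    assert (Hs2 : 1 / 2 <= s) by nra.
    assert (He : exp (- (2 * PI * N * s)) <= exp (- (PI * N))).
    { apply exp_le_compat. assert (PI * N * (1/2) <= PI * N * s) by (apply Rmult_le_compat_l; nra). lra. }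
    assert (Hw2 : exp (- (8 * (N * T))) <= exp (- (PI * N))).
    { apply exp_le_compat. assert (PI * N <= 8 * (N * T)); [|lra].
      assert (N * 1 <= N * T) by (apply Rmult_le_compat_l; lra). nra. }
    eapply Rle_trans; [|apply H2].
    replace (- (E * exp (- (2 * PI * N * s)))) with (E * - exp (- (2 * PI * N * s))) by ring.
    apply Rmult_le_compat_l; [lra|].
    assert (0 <= (k + 2 * PI) * t * exp (- (2 * N * T))) by (apply Rmult_le_pos; lra).
    lra.
Qed.

Lemma automorphy_factor_neq_0 (J : C -> C) (k x y : R) :
  (forall z, UHP z -> Cmod (J z) = Rpower (Cmod z) k) -> 0 < y -> J (x, y) <> RtoC 0.
Proof.
  intros HJ Hy E. assert (h := HJ (x, y) Hy). rewrite E, Cmod_0 in h.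
  assert (h' := exp_pos (k * ln (Cmod (x, y)))). unfold Rpower in h. lra.
Qed.

(** The frequency m / y^2 cancels the linear part of the phase: m x / |z|^2 - m x / y^2 = - m x^3 /
    (y^2 |z|^2), which leaves O(N t^3). The quotient J(iy) / J(z) has modulus at most 1 and differs
    from 1 by at most k t. *)
Lemma main_term_minorant (k m : R) (J : C -> C) (x y sg : R) :
  0 <= k -> 0 < m -> (forall z, UHP z -> Cmod (J z) = Rpower (Cmod z) k) ->
  holomorphic_on_UHP J -> 0 < y -> 0 < sg -> sg * sg = m / y ->
  exp (2 * PI * (m / y)) * (sg * (Rabs x / y) * exp (- (9 * (m / y) * (Rabs x / y * (Rabs x / y))))
     - (k + 2 * PI) * (Rabs x / y) * exp (- (2 * (m / y) * (Rabs x / y * (Rabs x / y))))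
     - 2 * exp (- (PI * (m / y)))) <=
  Re (J (0%R, y) / J (x, y) *
      e2pii (RtoC (- m) * ((- x / (x * x + y * y))%R, (y / (x * x + y * y))%R)) *
      cis (- (2 * PI * (m / (y * y)) * x)))%C.
Proof.
  intros Hk Hm HJ Hhol Hy Hs HN.
  assert (HPI := PI_RGT_0).
  assert (Hxx : Rabs x * Rabs x = x * x) by (assert (h := pow2_abs x); lra).
  assert (Hx0 := Rabs_pos x).
  assert (Hrho : 0 < x * x + y * y) by nra.
  set (q := (J (0%R, y) / J (x, y))%C).
  rewrite e2pii_pair.
  set (th := 2 * PI * - m * (- x / (x * x + y * y)) + - (2 * PI * (m / (y * y)) * x)).
  match goal with |- _ <= Re ?Z => replace Z with
    (RtoC (exp (2 * PI * (m / y) / (1 + Rabs x / y * (Rabs x / y)))) * (q * cis th))%C end.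
  2:{ unfold th. rewrite <- cis_add.
      replace (- (2 * PI * - m * (y / (x * x + y * y))))
        with (2 * PI * (m / y) / (1 + Rabs x / y * (Rabs x / y))).
      - ring.
      - replace (Rabs x / y * (Rabs x / y)) with (x * x / (y * y))
          by (rewrite <- Hxx; field; lra).
        field. repeat split; nra. }
  rewrite re_scal_l.
  assert (Hy2 := Cmod_pair_ge x y Hy).
  assert (HJ0 := HJ (0, y) Hy). assert (HJx := HJ (x, y) Hy).
  assert (HJn := automorphy_factor_neq_0 J k x y HJ Hy).
  assert (Hp : 0 < Rpower (Cmod (x, y)) k) by apply exp_pos.
  assert (Hq1 : Cmod q <= 1).
  { unfold q. rewrite Cmod_div, HJ0, HJx by easy.
    apply (Rmult_le_reg_r (Rpower (Cmod (x, y)) k)); [easy|].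
    unfold Rdiv. rewrite Rmult_assoc, Rinv_l, Rmult_1_r, Rmult_1_l by lra.
    apply Rle_Rpower_l; [easy|]. split.
    - assert (h := Cmod_pair_ge 0 y Hy). lra.
    - apply Cmod_pair_le_abs. rewrite Rabs_R0. easy. }
  assert (Hq2 : Cmod (q - 1)%C <= k * (Rabs x / y)).
  { replace (q - 1)%C with (- ((J (x, y) - J (0%R, y)) / J (x, y)))%C
      by (unfold q; field; easy).
    rewrite Cmod_opp, Cmod_div, HJx by easy.
    apply (Rmult_le_reg_r (Rpower (Cmod (x, y)) k)); [easy|].
    unfold Rdiv at 1. rewrite Rmult_assoc, Rinv_l, Rmult_1_r by lra.
    replace (k * (Rabs x / y)) with (k * Rabs x / y) by (field; lra).
    now apply automorphy_lipschitz. }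
  assert (Hth : Rabs th <= 2 * PI * (m / y) * (Rabs x / y * (Rabs x / y) * (Rabs x / y))).
  { replace th with (- (2 * PI * m * x * (x * x) / (y * y * (x * x + y * y))))
      by (unfold th; field; split; [nra|lra]).
    rewrite Rabs_Ropp. unfold Rdiv at 1. rewrite Rabs_mult, Rabs_inv, !Rabs_mult.
    rewrite (Rabs_pos_eq 2), (Rabs_pos_eq PI), (Rabs_pos_eq m), (Rabs_pos_eq y),
      (Rabs_pos_eq (x * x + y * y)) by lra.
    replace (2 * PI * (m / y) * (Rabs x / y * (Rabs x / y) * (Rabs x / y)))
      with (2 * PI * m * Rabs x * (Rabs x * Rabs x) * / (y * y * (y * y))) by (field; lra).
    apply Rmult_le_compat_l.
    - assert (0 <= PI * m * Rabs x) by (apply Rmult_le_pos; nra). nra.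
    - assert (0 < y * y) by nra. apply Rinv_le_contravar; [now apply Rmult_lt_0_compat|].
      apply Rmult_le_compat_l; nra. }
  assert (He := exp_pos (2 * PI * (m / y) / (1 + Rabs x / y * (Rabs x / y)))).
  assert (Ht : 0 <= Rabs x / y) by (apply Rmult_le_pos; [easy | apply Rlt_le, Rinv_0_lt_compat; lra]).
  apply saddle_point_minorant; try easy.
  - apply Rmult_le_compat_l; [lra|].
    replace (q * cis th)%C with (cis th + (q - 1) * cis th)%C by ring.
    rewrite re_plus. change (Re (cis th)) with (cos th).
    assert (h1 := one_minus_abs_le_cos th).
    assert (h2 := re_le_Cmod ((q - 1) * cis th)%C). rewrite Cmod_mult, Cmod_cis in h2.
    apply Rabs_le_between in h2. lra.
  - rewrite <- (Rmult_1_r (exp _)) at 1. rewrite Ropp_mult_distr_r.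
    apply Rmult_le_compat_l; [lra|].
    assert (h2 := re_le_Cmod (q * cis th)%C). rewrite Cmod_mult, Cmod_cis in h2.
    apply Rabs_le_between in h2. lra.
Qed.

(** * Error of the main term on the whole segment *)

(** Two sources limit [m'] from below: the second lowest exponent, where -1/z is high, and m/2,
    since elsewhere f grows at the halved rate exp(PI m / y). *)
Lemma modular_main_term_error (k : R) (f : C -> C) (j : SL2Z -> C -> C) (u : C) (a : R -> C)
    (m m' : R) :
  0 <= k -> modular_function k f j -> has_expansion f u a ->
  Lambda u (- m) -> 0 < m -> m / 2 <= m' <= m ->
  (forall l, Lambda u l -> a l <> RtoC 0 -> l <> - m -> - m' <= l) ->
  exists A, 0 <= A /\ forall x y, Rabs x <= 1/2 -> 0 < y < 1/2 ->
    Cmod (f (x, y) - a (- m)%R *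
      e2pii (RtoC (- m) * ((- x / (x * x + y * y))%R, (y / (x * x + y * y))%R))
      / j inversion_matrix (x, y))%C <= A / Rpower y k * exp (2 * PI * m' / y).
Proof.
  intros Hk Hmod Hexp Lm Hm Hm' Hgap.
  assert (HPI := PI_RGT_0).
  destruct (expansion_principal_part_bound f u a m m' Hexp Lm) as [A [HA0 HA]];
    [lra | easy |].
  set (al := Cmod (a (- m))).
  assert (Hal : 0 <= al) by apply Cmod_ge_0.
  assert (Hhigh : forall x y, 1/2 <= y -> Cmod (f (x, y)) <= (A + al) * exp (2 * PI * m * y)).
  { intros x y Hy. specialize (HA x y Hy).
    assert (T := Cmod_triangle (f (x, y) - a (- m)%R * e2pii (RtoC (- m) * (x, y)))%C
                    (a (- m)%R * e2pii (RtoC (- m) * (x, y)))%C).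
    rewrite (Cmod_mult (a (- m))), Cmod_e2pii in T. fold al in T.
    match type of T with Cmod ?Z <= _ => replace Z with (f (x, y)) in T by ring end.
    replace (- (2 * PI * - m * y)) with (2 * PI * m * y) in T by ring.
    assert (exp (2 * PI * m' * y) <= exp (2 * PI * m * y)).
    { apply exp_le_compat. apply Rmult_le_compat_r; [lra|]. nra. }
    nra. }
  exists (A + (A + al) + al). split; [lra|]. intros x y Hx Hy.
  destruct (proj2 (proj1 (proj2 Hmod) inversion_matrix) (x, y) (proj1 Hy)) as [HJ Hf].
  rewrite moebius_inversion in Hf by lra. rewrite denom_inversion in HJ.
  set (J := j inversion_matrix (x, y)) in *.
  set (v := y / (x * x + y * y)) in *. set (xi := - x / (x * x + y * y)) in *.
  assert (Hry := Cmod_pair_ge x y (proj1 Hy)).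
  assert (Hp : 0 < Rpower y k) by apply exp_pos.
  assert (Hpr : Rpower y k <= Rpower (Cmod (x, y)) k) by (apply Rle_Rpower_l; lra).
  set (p := Rpower y k) in *. set (pr := Rpower (Cmod (x, y)) k) in *.
  assert (HJ0 : J <> RtoC 0) by (intros E; rewrite E, Cmod_0 in HJ; lra).
  assert (Hip : 0 < / p) by now apply Rinv_0_lt_compat.
  assert (Hipr : / pr <= / p) by now apply Rinv_le_contravar.
  assert (Hipr0 : 0 < / pr) by (apply Rinv_0_lt_compat; lra).
  assert (He := exp_pos (2 * PI * m' / y)).
  assert (Hvy : v <= / y).
  { unfold v. replace (/ y) with (y * / (y * y)) by (field; lra).
    unfold Rdiv. apply Rmult_le_compat_l; [lra|]. apply Rinv_le_contravar; nra. }
  destruct (Rle_dec (1/2) v) as [Hv|Hv].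
  - specialize (HA xi v Hv). rewrite Hf in HA.
    match type of HA with Cmod (_ - ?M)%C <= _ =>
      replace (f (x, y) - M / J)%C with ((J * f (x, y) - M) / J)%C by (field; easy) end.
    rewrite Cmod_div, HJ by easy.
    assert (Hexpv : exp (2 * PI * m' * v) <= exp (2 * PI * m' / y)).
    { apply exp_le_compat. unfold Rdiv. apply Rmult_le_compat_l; [nra | easy]. }
    apply Rle_trans with (A * exp (2 * PI * m' / y) * / p).
    + unfold Rdiv. apply Rmult_le_compat; [apply Cmod_ge_0 | lra | | easy].
      eapply Rle_trans; [apply HA|]. now apply Rmult_le_compat_l.
    + set (E := exp (2 * PI * m' / y)) in *. unfold Rdiv.
      assert (0 <= (A + 2 * al) * (/ p * E)) by (apply Rmult_le_pos; nra). lra.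
  (* No comparison is attempted here: f and the main term are bounded separately, the latter because
     v < 1/2 keeps its exponential below exp(PI m). *)
  - assert (Hminor := modular_minor_arc_bound k f j (A + al) m Hk
      ltac:(lra) ltac:(lra) Hmod Hhigh x y Hx Hy ltac:(fold v; lra)).
    fold p in Hminor.
    eapply Rle_trans; [apply Cmod_triangle|]. rewrite Cmod_opp, Cmod_div, HJ by easy.
    rewrite Cmod_mult, Cmod_e2pii. fold al.
    assert (Hiy : 1 <= / y).
    { rewrite <- Rinv_1. apply Rinv_le_contravar; lra. }
    assert (E1 : exp (PI * m / y) <= exp (2 * PI * m' / y)).
    { apply exp_le_compat. unfold Rdiv. apply Rmult_le_compat_r; [lra|]. nra. }
    assert (E2 : exp (- (2 * PI * - m * v)) <= exp (2 * PI * m' / y)).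
    { apply exp_le_compat. unfold Rdiv.
      apply Rle_trans with (2 * PI * m' * 1); [|apply Rmult_le_compat_l; nra].
      assert (PI * (m * v) <= PI * m'); [|nra]. apply Rmult_le_compat_l; nra. }
    apply Rle_trans with ((A + al) / p * exp (2 * PI * m' / y) +
       al * exp (2 * PI * m' / y) * / p).
    + apply Rplus_le_compat.
      * eapply Rle_trans; [apply Hminor|]. apply Rmult_le_compat_l; [|easy].
        apply Rmult_le_pos; lra.
      * unfold Rdiv at 1. apply Rmult_le_compat; try lra.
        -- apply Rmult_le_pos; [easy | apply Rlt_le, exp_pos].
        -- now apply Rmult_le_compat_l.
    + set (E := exp (2 * PI * m' / y)) in *. unfold Rdiv.
      assert (0 <= A * (/ p * E)) by (apply Rmult_le_pos; nra). lra.
Qed.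

(** * Integration of the minorant *)

Lemma saddle_point_primitive (k N y sg K x : R) : 0 < y -> 0 < N ->
  is_derive (fun x => - (sg * y / (18 * N)) * exp (- (9 * N * (x / y * (x / y))))
      + (k + 2 * PI) * y / (4 * N) * exp (- (2 * N * (x / y * (x / y)))) - K * x) x
    (sg * (x / y) * exp (- (9 * N * (x / y * (x / y))))
      - (k + 2 * PI) * (x / y) * exp (- (2 * N * (x / y * (x / y)))) - K).
Proof.
  intros Hy HN. auto_derive; [easy|]. unfold Rdiv.
  generalize (exp (- (9 * N * (x * / y * (x * / y))))).
  generalize (exp (- (2 * N * (x * / y * (x * / y))))).
  intros e1 e2. field. lra.
Qed.

(** With y = m / N every term is a multiple of N^(-2), or bounded by one; only the first carries the
    extra factor [sg], the square root of N. [W] collects the constants of the others, so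
    [sg > 36 W / m] is enough. *)
Lemma saddle_point_gap_positive (k m c d : R) :
  0 <= k -> 0 < m -> 0 <= c -> 0 < d ->
  exists K, 0 <= K /\ forall sg y, K < sg -> 0 < y < 1/2 -> 1 <= m / y -> sg * sg = m / y ->
    0 < sg * y / (18 * (m / y)) * (1 - exp (- (9 * (m / y) * (1/2 / y * (1/2 / y)))))
      - (k + 2 * PI) * y / (4 * (m / y))
      - (2 * exp (- (PI * (m / y))) + c * exp (- (d * (m / y)))) * (1/2).
Proof.
  intros Hk Hm Hc Hd.
  assert (HPI3 : 3 < PI) by (assert (h := PI2_3_2); lra).
  assert (Hd3 : 0 < d * d * d) by (repeat apply Rmult_lt_0_compat; easy).
  set (q := 27 / (d * d * d)).
  assert (Hq : 0 < q) by (apply Rdiv_lt_0_compat; lra).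
  assert (Hcq : 0 <= c * q) by (apply Rmult_le_pos; lra).
  set (W := m * (k + 2 * PI) / 4 + 1 + c * q).
  assert (HW : 0 < W) by (unfold W; nra).
  exists (36 / m * W).
  assert (H36 : 0 < 36 / m) by (apply Rdiv_lt_0_compat; lra).
  split; [nra|]. intros sg y HK Hy HN1 HN.
  assert (Hyy : 0 < y * y) by nra.
  assert (Hym : y = m / (m / y)) by (field; lra).
  assert (Hhalf : 1 <= 1/2 / y).
  { apply (Rmult_le_reg_r y); [lra|]. unfold Rdiv at 1.
    rewrite Rmult_assoc, Rinv_l; lra. }
  set (r := 1/2 / y) in *. clearbody r.
  set (N := m / y) in *. clearbody N. rewrite Hym. clear Hym.
  assert (Hsg : 0 < sg) by nra.
  assert (HWs : W < m * sg / 36).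
  { apply (Rmult_lt_reg_l (36 / m)); [easy|].
    replace (36 / m * (m * sg / 36)) with sg by (field; lra). easy. }
  assert (HN3 : 0 < N * N * N) by (repeat apply Rmult_lt_0_compat; lra).
  (* The end x = 1/2 lies at t = [r] >= 1, where the Gaussian is at most 1/2; this halving turns the
     18 of the primitive into the 36 of the witness. *)
  assert (E1 : exp (- (9 * N * (r * r))) <= 1/2).
  { apply Rle_trans with (exp (- (1))).
    - apply exp_le_compat. assert (1 <= r * r) by nra. nra.
    - rewrite exp_Ropp. replace (1/2) with (/ 2) by field.
      apply Rinv_le_contravar; [lra|]. assert (h := exp_ineq1_le 1). lra. }
  assert (E2 : exp (- (PI * N)) <= / (N * N * N)).
  { eapply Rle_trans; [apply exp_opp_le_inv_cube; nra|].
    replace (27 / (PI * N * (PI * N) * (PI * N)))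
      with (27 / (PI * PI * PI) * / (N * N * N)) by (field; lra).
    rewrite <- (Rmult_1_l (/ (N * N * N))) at 2.
    apply Rmult_le_compat_r; [apply Rlt_le, Rinv_0_lt_compat; easy|].
    assert (27 <= PI * PI * PI) by nra.
    apply (Rmult_le_reg_r (PI * PI * PI)); [lra|].
    unfold Rdiv. rewrite Rmult_assoc, Rinv_l; lra. }
  assert (E3 : exp (- (d * N)) <= q / (N * N * N)).
  { eapply Rle_trans; [apply exp_opp_le_inv_cube; nra|].
    apply Req_le. unfold q. field. lra. }
  assert (Hi3 : / (N * N * N) <= / (N * N)).
  { apply Rinv_le_contravar; nra. }
  assert (Hi2 : 0 < / (N * N)) by (apply Rinv_0_lt_compat; nra).
  assert (Hi30 : 0 < / (N * N * N)) by now apply Rinv_0_lt_compat.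
  set (i3 := / (N * N * N)) in *. set (i2 := / (N * N)) in *.
  replace (sg * (m / N) / (18 * N)) with (m * sg / 18 * i2) by (unfold i2; field; lra).
  replace ((k + 2 * PI) * (m / N) / (4 * N)) with (m * (k + 2 * PI) / 4 * i2)
    by (unfold i2; field; lra).
  assert (T1 : m * sg / 36 * i2 <= m * sg / 18 * i2 * (1 - exp (- (9 * N * (r * r))))).
  { replace (m * sg / 36 * i2) with (m * sg / 18 * i2 * (1/2)) by field.
    apply Rmult_le_compat_l; [|lra]. apply Rmult_le_pos; nra. }
  assert (T2 : exp (- (PI * N)) <= i2) by lra.
  assert (T3 : c * exp (- (d * N)) <= c * q * i2).
  { rewrite Rmult_assoc. apply Rmult_le_compat_l; [easy|].
    eapply Rle_trans; [apply E3|]. unfold Rdiv. apply Rmult_le_compat_l; [lra|easy]. }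
  assert (T4 : W * i2 < m * sg / 36 * i2) by (apply Rmult_lt_compat_r; lra).
  unfold W in T4. assert (0 <= c * q * i2) by (apply Rmult_le_pos; lra). lra.
Qed.

(** * Choice of constants and contradiction with a vanishing coefficient *)

Theorem mainTheorem5 :
  forall (k : R) (f : C -> C) (j : SL2Z -> C -> C) (u : C) (a : R -> C),
    0 <= k ->
    modular_function k f j ->
    (exists z : C, UHP z /\ f z <> RtoC 0) ->
    (forall z : C, UHP z -> j translation z = u) ->
    has_expansion f u a ->
    (exists mu : R, mu < 0 /\ Lambda u mu /\ a mu <> RtoC 0) ->
    exists lambda0 : R, 0 < lambda0 /\
      forall lambda : R, Lambda u lambda -> lambda0 <= lambda ->
        a lambda <> RtoC 0.
Proof.
  intros k f j u a Hk Hmod _ Hu Hexp Hmu.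
  assert (HPI := PI_RGT_0).
  destruct (modular_lowest_exponent k f j u a Hmod Hu Hexp Hmu)
    as [m [Hm [Lm [Am Hgap]]]].
  (* [m - 1] comes from the gap after the lowest exponent, [m / 2] from the minor arcs; both are
     below [m]. *)
  set (m' := Rmax (m - 1) (m / 2)).
  assert (Hm1 : m - 1 <= m') by apply Rmax_l.
  assert (Hm2 : m / 2 <= m') by apply Rmax_r.
  assert (Hm3 : m' < m) by (apply Rmax_lub_lt; lra).
  destruct (modular_main_term_error k f j u a m m' Hk Hmod Hexp Lm Hm)
    as [A [HA0 HA]]; [lra | |].
  { intros l Ll Al Hl. specialize (Hgap l Ll Al Hl). lra. }
  set (J := j inversion_matrix) in HA.
  assert (HJ : forall z, UHP z -> Cmod (J z) = Rpower (Cmod z) k).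
  { intros z Hz. rewrite <- (denom_inversion z) at 2.
    apply (proj2 (proj1 (proj2 Hmod) inversion_matrix) z Hz). }
  assert (HJhol : holomorphic_on_UHP J) by apply (proj1 (proj1 (proj2 Hmod) inversion_matrix)).
  set (a0 := a (- m)) in *.
  assert (Hal : 0 < Cmod a0) by now apply Cmod_gt_0.
  (* Relative to the main term exp(2 pi N), the error will be c exp(-d N), with d N = 2 pi (m - m')
     / y. *)
  set (c := A / Cmod a0). set (d := 2 * PI * (m - m') / m).
  assert (Hc : 0 <= c) by (apply Rmult_le_pos; [easy | apply Rlt_le, Rinv_0_lt_compat; easy]).
  assert (Hd : 0 < d) by (apply Rdiv_lt_0_compat; nra).
  destruct (saddle_point_gap_positive k m c d Hk Hm Hc Hd) as [K [HK0 HK]].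
  (* For y <= y0 this gives N >= K^2 + 1 + 2m: the part K^2 + 1 yields sqrt(N) > K and N >= 1, the
     part 2m yields y < 1/2. *)
  set (y0 := m / (K * K + 1 + 2 * m)).
  assert (Hy00 : 0 < y0) by (apply Rdiv_lt_0_compat; nra).
  exists (m / (y0 * y0)). split; [apply Rdiv_lt_0_compat; nra|].
  intros lam Llam Hlam Halam.
  assert (Hlam0 : 0 < lam).
  { eapply Rlt_le_trans; [|apply Hlam]. apply Rdiv_lt_0_compat; nra. }
  set (y := sqrt (m / lam)).
  assert (Hml : 0 < m / lam) by now apply Rdiv_lt_0_compat.
  assert (Hy : 0 < y) by now apply sqrt_lt_R0.
  assert (Hyy : y * y = m / lam) by (apply sqrt_sqrt; lra).
  assert (Hlamy : lam = m / (y * y)) by (rewrite Hyy; field; lra).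
  assert (Hyy0 : y <= y0).
  { apply Rnot_lt_le. intros Hlt.
    assert (y0 * y0 < y * y) by nra.
    assert (m / (y * y) < m / (y0 * y0)); [|lra].
    unfold Rdiv. apply Rmult_lt_compat_l; [easy|]. apply Rinv_lt_contravar; [|easy].
    apply Rmult_lt_0_compat; nra. }
  clearbody y.
  assert (HN : K * K + 1 + 2 * m <= m / y).
  { replace (K * K + 1 + 2 * m) with (m / y0) by (unfold y0; field; nra).
    unfold Rdiv. apply Rmult_le_compat_l; [lra|]. now apply Rinv_le_contravar. }
  assert (HNy : m / y * y = m) by (field; lra).
  assert (Hy1 : y < 1/2) by nra.
  set (sg := sqrt (m / y)).
  assert (Hsg : sg * sg = m / y) by (apply sqrt_sqrt; nra).
  assert (Hsg0 : 0 < sg) by (apply sqrt_lt_R0; nra).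
  assert (HsgK : K < sg) by nra.
  clearbody sg.
  assert (Hpos := HK sg y HsgK (conj Hy Hy1) ltac:(nra) Hsg).
  set (N := m / y) in *.
  assert (HN0 : 0 < N) by nra.
  set (D := 2 * exp (- (PI * N)) + c * exp (- (d * N))) in *.
  set (p := fun x => - (sg * y / (18 * N)) * exp (- (9 * N * (x / y * (x / y))))
      + (k + 2 * PI) * y / (4 * N) * exp (- (2 * N * (x / y * (x / y)))) - D * x).
  set (p' := fun x => sg * (x / y) * exp (- (9 * N * (x / y * (x / y))))
      - (k + 2 * PI) * (x / y) * exp (- (2 * N * (x / y * (x / y)))) - D).
  set (E := exp (2 * PI * N)).
  assert (HE : 0 < E) by apply exp_pos.
  (* At x = 0 this makes the main term real and positive; its modulus y^k / |a0| absorbs the y^(-k)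
     of the error. *)
  set (kap := (J (0%R, y) / a0)%C).
  assert (Hkap : Cmod kap = Rpower y k / Cmod a0).
  { unfold kap. rewrite Cmod_div, HJ by easy. f_equal. f_equal.
    assert (h := Cmod_pair_sqr 0 y). assert (h' := Cmod_ge_0 (0%R, y)). nra. }
  assert (Hmin : forall x, Rabs x <= 1/2 ->
    E * p' (Rabs x) <= Re (kap * f (x, y) * cis (- (2 * PI * lam * x)))%C).
  { intros x Hx.
    assert (H1 := main_term_minorant k m J x y sg Hk Hm HJ HJhol Hy Hsg0 Hsg).
    fold N E in H1. rewrite <- Hlamy in H1.
    assert (H2 := HA x y Hx (conj Hy Hy1)).
    assert (HJx := automorphy_factor_neq_0 J k x y HJ Hy).
    set (e := e2pii _) in *.
    replace (kap * f (x, y) * cis (- (2 * PI * lam * x)))%C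
      with (J (0%R, y) / J (x, y) * e * cis (- (2 * PI * lam * x)) +
            kap * (f (x, y) - a0 * e / J (x, y)) * cis (- (2 * PI * lam * x)))%C
      by (unfold kap; field; split; easy).
    rewrite re_plus.
    assert (H3 : Cmod (kap * (f (x, y) - a0 * e / J (x, y)) * cis (- (2 * PI * lam * x)))%C
                 <= E * (c * exp (- (d * N)))).
    { rewrite !Cmod_mult, Cmod_cis, Hkap, Rmult_1_r.
      assert (Hp : 0 < Rpower y k) by apply exp_pos.
      replace (E * (c * exp (- (d * N)))) with
        (Rpower y k / Cmod a0 * (A / Rpower y k * exp (2 * PI * m' / y))).
      - apply Rmult_le_compat_l; [|easy].
        apply Rmult_le_pos; [lra | apply Rlt_le, Rinv_0_lt_compat; easy].
      - replace (2 * PI * m' / y) with (2 * PI * N + - (d * N))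
          by (unfold d, N; field; lra).
        rewrite exp_plus. fold E. unfold c. field. lra. }
    match type of H3 with Cmod ?Z <= _ => assert (H4 := re_le_Cmod Z) end.
    apply Rabs_le_between in H4.
    unfold p', D. lra. }
  assert (HF := coefficient_lower_bound f u a lam y kap (fun x => E * p x) (fun x => E * p' x)
    Hexp Llam Hy).
  rewrite Halam in HF.
  replace (Re (kap * RtoC 0)%C) with 0 in HF by (simpl; ring).
  rewrite Rmult_0_l in HF.
  assert (Hle : 2 * (E * p (1/2) - E * p 0) <= 0).
  { apply HF.
    - intros x _. apply (is_derive_scal p x E). now apply saddle_point_primitive.
    - intros x Hx. split.
      + assert (h := Hmin x). rewrite Rabs_pos_eq in h by lra. apply h; lra.
      + assert (h := Hmin (- x)). rewrite Rabs_Ropp, Rabs_pos_eq in h by lra. apply h; lra. }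
  (* The second Gaussian at x = 1/2 is positive and may be dropped; what remains is the quantity in
     [Hpos]. *)
  assert (Hpp : 0 < p (1/2) - p 0).
  { unfold p. replace (0 / y * (0 / y)) with 0 by (field; lra).
    rewrite !Rmult_0_r, Ropp_0, exp_0.
    assert (h := exp_pos (- (2 * N * (1/2 / y * (1/2 / y))))).
    assert (0 < (k + 2 * PI) * y / (4 * N)).
    { apply Rdiv_lt_0_compat; nra. }
    nra. }
  nra.
Qed.
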